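(* Assume that there is no $a\in\mathbb{Q}$ such that $g_a(z)=\frac{az^2-1}{z^3-az}$ has a $\mathbb{Q}$-rational periodic point of minimal period at least $4$. Then the possible $\mathbb{Q}$-rational preperiodic structures for $g_a$, $a\in\mathbb{Q}$ (with $a\neq\pm1$ throughout), are the following. $G_1$: the two $2$-cycles $1\leftrightarrow-1$ and $0\leftrightarrow\infty$ (total $4$ points); for $a$ not in the following cases. $G_2$: the two $2$-cycles $1\leftrightarrow-1$ and $0\leftrightarrow\infty$, and the four fixed points $t,-t,1/t,-1/t$ (total $8$ points); for $a=\frac{t^4+1}{2t^2}$, $t\in\mathbb{Q}\setminus\{\pm1,0\}$. $G_{3a}$: the two $2$-cycles $1\leftrightarrow-1$ and $0\leftrightarrow\infty$, where each of $0$ and $\infty$ has exactly two non-periodic rational preimages (total $8$ points); for $a=t^2$, $t\in\mathbb{Q}\setminus\{0\}$. $G_{3b}$: the two $2$-cycles $1\leftrightarrow-1$ and $0\leftrightarrow\infty$, where each of $1$ and $-1$ has exactly two non-periodic rational preimages (total $8$ points); for $a=\frac{3t^2+3t+3}{2t^2+5t+2}$, $t\in\mathbb{Q}\setminus\{-2,-\tfrac12\}$.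
   Context: The $\mathbb{Q}$-rational preperiodic structure of $g$ is the directed graph whose vertices are the points of $\mathbb{P}^1(\mathbb{Q})$ that are preperiodic for $g$, with an edge $P\to g(P)$ for each vertex $P$; in the descriptions all vertices and edges are listed. The values $a=\pm1$ are excluded throughout, since the map then has degree less than $3$; parameters $t$ giving such $a$ are correspondingly not considered.
   Formalization: In G_{3b} the value t=-1 is also excluded: it gives a=-3, where g_a(z)=1 means (z+1)^3=0, so 1 has no non-periodic rational preimage and the printed claim fails; a=-3 then falls under G_1. *)

(* Defs.v *)
From HB Require Import structures.
From mathcomp Require Import all_boot all_order all_algebra.

Set Implicit Arguments.
Unset Strict Implicit.
Unset Printing Implicit Defensive.

Import Order.TTheory GRing.Theory Num.Theory.

Local Open Scope ring_scope.

(* P^1(Q): [Some z] is the point [z : 1], [None] is the point at infinity. *)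
Notation P1Q := (option rat).
Notation "∞" := (None : P1Q) (at level 0).

(* The self-map of P^1(Q) given by p / q, for coprime p and q.  With
   d = max(deg p, deg q), homogenising p and q in degree d shows that infinity
   goes to [p_d : q_d]; [size] is the degree plus one. *)
Definition ratmap (p q : {poly rat}) (P : P1Q) : P1Q :=
  let d := (maxn (size p) (size q)).-1 in
  let: (x, y) := if P is Some z then (p.[z], q.[z]) else (p`_d, q`_d) in
  if y == 0 then ∞ else Some (x / y).

(* For a = 1 and a = -1 numerator and denominator have a common factor; these
   values are excluded wherever [g] is used. *)
Definition g (a : rat) : P1Q -> P1Q :=
  ratmap (a *: 'X^2 - 1) ('X^3 - a *: 'X).

Definition has_min_period (T : Type) (f : T -> T) (n : nat) (P : T) : Prop :=
  [/\ (0 < n)%N, iter n f P = P &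
      forall m : nat, (0 < m < n)%N -> iter m f P <> P].

Definition periodic (T : Type) (f : T -> T) (P : T) : Prop :=
  exists2 n : nat, (0 < n)%N & iter n f P = P.

Definition preperiodic (T : Type) (f : T -> T) (P : T) : Prop :=
  exists m : nat, periodic f (iter m f P).

Record digraph (T : Type) := Digraph {
  vertex : T -> Prop;
  edge : T -> T -> Prop
}.

Definition preper_structure (T : Type) (f : T -> T) : digraph T :=
  Digraph (preperiodic f) (fun P Q => preperiodic f P /\ Q = f P).

(* [uniq V] makes the number of vertices equal to [size V]. *)
Definition digraph_is (T : eqType) (G : digraph T)
    (V : seq T) (E : seq (T * T)) : Prop :=
  [/\ uniq V, forall P, vertex G P <-> P \in V &
      forall P Q, edge G P Q <-> (P, Q) \in E].

Definition cyclesV : seq P1Q := [:: Some 1; Some (-1); Some 0; ∞].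

Definition cyclesE : seq (P1Q * P1Q) :=
  [:: (Some 1, Some (-1)); (Some (-1), Some 1); (Some 0, ∞); (∞, Some 0)].

Definition is_G1 (G : digraph P1Q) : Prop := digraph_is G cyclesV cyclesE.

Definition is_G2 (t : rat) (G : digraph P1Q) : Prop :=
  let fixV : seq P1Q :=
    [:: Some t; Some (- t); Some (1 / t); Some (- (1 / t))] in
  digraph_is G (cyclesV ++ fixV) (cyclesE ++ [seq (P, P) | P <- fixV]).

(* The two 2-cycles, two further vertices P1, P2 mapping to A, and two further
   vertices Q1, Q2 mapping to B.  The further vertices have no incoming edge,
   so they are not periodic. *)
Definition is_G3 (A B : P1Q) (G : digraph P1Q) : Prop :=
  exists P1 P2 Q1 Q2 : P1Q,
    digraph_is G (cyclesV ++ [:: P1; P2; Q1; Q2])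
      (cyclesE ++ [:: (P1, A); (P2, A); (Q1, B); (Q2, B)]).

Definition is_G3a : digraph P1Q -> Prop := is_G3 (Some 0) ∞.

Definition is_G3b : digraph P1Q -> Prop := is_G3 (Some 1) (Some (-1)).

Definition param2 (a t : rat) : Prop :=
  [/\ t != 1, t != -1, t != 0 & a = (t ^+ 4 + 1) / (2 * t ^+ 2)].

Definition param3a (a t : rat) : Prop := t != 0 /\ a = t ^+ 2.

(* The formula gives (a - 1)(a + 3) = (3(t^2 - 1) / ((2t + 1)(t + 2)))^2, the
   discriminant of z^2 - (1 + a) z + 1, whose roots are the preimages of 1
   other than -1.  At t = -1, i.e. a = -3, it is (z + 1)^2, so 1 has no
   non-periodic preimage: the structure there is G_1, and t = -1 has to be
   excluded. *)
Definition param3b (a t : rat) : Prop :=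
  [/\ t != -2, t != - (1 / 2), t != -1 &
      a = (3 * t ^+ 2 + 3 * t + 3) / (2 * t ^+ 2 + 5 * t + 2)].

(* Main.v *)
Require Import Defs.
From Stdlib Require Import ZArith Znumtheory Classical_Prop.
From HB Require Import structures.
From mathcomp Require Import all_boot all_order all_algebra.
From mathcomp Require Import zify ssrZ ring lra.

Set Implicit Arguments.
Unset Strict Implicit.
Unset Printing Implicit Defensive.

Import Order.TTheory GRing.Theory Num.Theory.

(* MathComp takes the key [%Z] for [int]. *)
Delimit Scope Z_scope with BZ.
Local Open Scope ring_scope.

(** The map commutes with [z -> -z] and [z -> 1/z], and [z -> (z - 1)/(z + 1)]
    conjugates [g a] to [g a'] with [a' = (a + 3)/(a - 1)], exchanging the two
    2-cycles.  Periods 1 and 2 are explicit, and each configuration that has to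
    be excluded gives a rational point on one of four elliptic curves of rank 0:
    - fixed points together with preimages of a 2-cycle: conductor 32;
    - preimages of both 2-cycles, or preimages of a fixed point: conductor 24;
    - second preimages of a 2-cycle: conductor 20;
    - 3-cycles: the polynomial of points of period 3 is, in [z^2 + 1/z^2], a norm
      form [A^2 - D B^2] with [D = (a^2 + 7)(a^4 + 3a^2 + 4)], and
      [y^2 = D] covers a curve of conductor 14.
    The rational points of these curves come from descent by 2-isogeny, with the
    naive height of the abscissa decreasing until a finite search applies. *)

(** * Integers, rationals and heights *)

(** The list is finite because tails have length at most one: a rational preperiodic point off the
    two 2-cycles is fixed or maps straight into a 2-cycle. Such [exceptional] points are roots of
    five polynomials, and their existence makes [a] a square (preimages of 0 and infinity), or (a -
    1)(a + 3) a square (preimages of 1 and -1), or a^2 - 1 a square (fixed points). Two conditions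
    at once make a product such as a(a - 1)(a + 1) or a(a - 1)(a + 3) a square, which is a point on
    an elliptic curve. When only one holds, the exceptional points form a single orbit of four under
    -z and 1/z.

    The descent speaks of abscissas alone. Translation by a rational 2-torsion point turns an
    abscissa into a square; on the 2-isogenous curve every abscissa is, up to translation by (0, 0),
    already a square. So each point can be halved after translation, and halving takes the height to
    about its fourth root.

    For 3-cycles the difficulty is the degree, 24 in z. The symmetries bring it down to 6 in z^2 +
    1/z^2, and the factorization over Q(sqrt D) leaves a condition on [a] alone: D must be a
    square. *)

(* Locked, so that [ring] and [field] treat [zq z] as an atom. *)
Definition zq : Z -> rat := locked (fun z => (int_of_Z z)%:~R).

Arguments zq z%_BZ.

Lemma zqE z : zq z = (int_of_Z z)%:~R.
Proof. by rewrite /zq -lock. Qed.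

Lemma zqD x y : zq (x + y)%BZ = zq x + zq y.
Proof. by rewrite !zqE -rmorphD -(rmorphD int_of_Z). Qed.

Lemma zqM x y : zq (x * y)%BZ = zq x * zq y.
Proof. by rewrite !zqE -rmorphM -(rmorphM int_of_Z). Qed.

Lemma zqN x : zq (- x)%BZ = - zq x.
Proof. by rewrite !zqE -rmorphN -(rmorphN int_of_Z). Qed.

Lemma zqB x y : zq (x - y)%BZ = zq x - zq y.
Proof. by rewrite -zqN -zqD. Qed.

Lemma zq_inj : injective zq.
Proof. by move=> x y; rewrite !zqE => /intr_inj /(can_inj int_of_ZK). Qed.

Lemma zq0 : zq 0 = 0.
Proof. by rewrite zqE. Qed.

Lemma zq1 : zq 1 = 1.
Proof. by rewrite zqE. Qed.

Lemma zq_eq0 x : (zq x == 0) = (x == 0%BZ).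
Proof. by rewrite -zq0 (inj_eq zq_inj). Qed.

Lemma zq_neq0 x : x <> 0%BZ -> zq x != 0.
Proof. by move=> h; rewrite zq_eq0; apply/eqP. Qed.

Lemma rat_zq (x : rat) : exists m n : Z,
  [/\ (0 < n)%BZ, Z.gcd m n = 1%BZ & x = zq m / zq n].
Proof.
exists (Z_of_int (numq x)), (Z_of_int (denq x)).
rewrite !zqE !Z_of_intK divq_num_den; split=> //.
- by have := denq_gt0 x; lia.
- by have := coprime_num_den x; rewrite -coprimezE; lia.
Qed.

Definition height (x : rat) : Z :=
  Z.max (Z.abs (Z_of_int (numq x))) (Z_of_int (denq x)).

Lemma height_gt0 x : (0 < height x)%BZ.
Proof. by have := denq_gt0 x; rewrite /height; lia. Qed.

(** Cancellation stays as an explicit factor, so that heights can be bounded from fractions that are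
    not in lowest terms. *)
Lemma height_frac A B : B <> 0%BZ ->
  (height (zq A / zq B) * Z.gcd A B)%BZ = Z.max (Z.abs A) (Z.abs B).
Proof.
move=> B0; rewrite !zqE.
move eA: (int_of_Z A) => A'; move eB: (int_of_Z B) => B'.
have {eA}-> : A = Z_of_int A' by rewrite -eA int_of_ZK.
have {eB B0}[eB B0]: B = Z_of_int B' /\ B' <> 0.
  by rewrite -eB int_of_ZK; split=> //; lia.
rewrite eB; case: divqP B0 => // k x k0 _; rewrite /height.
have h1 : (0 < Z_of_int (denq x))%BZ by have := denq_gt0 x; lia.
have h2 : Z.gcd (Z_of_int (numq x)) (Z_of_int (denq x)) = 1%BZ.
  by have := coprime_num_den x; rewrite -coprimezE; lia.
have -> u : Z_of_int (k * u) = (Z_of_int k * Z_of_int u)%BZ by lia.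
have -> u : Z_of_int (k * u) = (Z_of_int k * Z_of_int u)%BZ by lia.
rewrite Z.gcd_mul_mono_l h2; nia.
Qed.

Lemma Zgcd1M a b c : Z.gcd a b = 1%BZ -> Z.gcd a c = 1%BZ ->
  Z.gcd a (b * c) = 1%BZ.
Proof.
move=> /Zgcd_1_rel_prime ab /Zgcd_1_rel_prime ac.
exact/Zgcd_1_rel_prime/rel_prime_mult.
Qed.

(* So [|m|] times a divisor of [k] is a square, with no factorization needed. *)
Lemma gcd_of_square m k s : (m * k = s * s)%BZ ->
  (Z.gcd m s * Z.gcd m s = Z.abs m * Z.gcd m k)%BZ.
Proof.
move=> mks; have [m0|m0] := Z.eq_dec m 0.
  have s0 : s = 0%BZ by nia.
  by rewrite m0 s0.
have g0 : Z.gcd m s <> 0%BZ by move=> /Z.gcd_eq_0_l.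
have [m' [s' [em es cop]]] : exists m' s', [/\ m = (Z.gcd m s * m')%BZ,
    s = (Z.gcd m s * s')%BZ & Z.gcd m' s' = 1%BZ].
  have [m' em] := Z.gcd_divide_l m s; have [s' es] := Z.gcd_divide_r m s.
  exists m', s'; split; try lia.
  have := Z.gcd_mul_mono_l m' s' (Z.gcd m s).
  have -> : (Z.gcd m s * m')%BZ = m by lia.
  have -> : (Z.gcd m s * s')%BZ = s by lia.
  by have := Z.gcd_nonneg m s; nia.
set d := Z.gcd m s in g0 em es *.
have dge0 : (0 <= d)%BZ by apply: Z.gcd_nonneg.
have e1 : (m' * k = d * (s' * s'))%BZ.
  by apply: (Z.mul_reg_l _ _ d) => //; nia.
have cop2 : Z.gcd m' (s' * s') = 1%BZ by apply: Zgcd1M.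
have [e de] : (m' | d)%BZ.
  apply: (Gauss _ (s' * s')); last exact/Zgcd_1_rel_prime.
  by exists k; nia.
have m'0 : m' <> 0%BZ by nia.
have ek : k = (e * (s' * s'))%BZ by apply: (Z.mul_reg_l _ _ m') => //; nia.
have cop3 : Z.gcd (m' * m') (s' * s') = 1%BZ.
  by rewrite Z.gcd_comm; apply: Zgcd1M; rewrite Z.gcd_comm.
have -> : Z.gcd m k = Z.abs e.
  have -> : m = (e * (m' * m'))%BZ by nia.
  by rewrite ek Z.gcd_mul_mono_l cop3 Z.mul_1_r.
nia.
Qed.

Lemma zq_sqrt (y : rat) (k : Z) : y ^+ 2 = zq k -> exists s : Z, y = zq s.
Proof.
have [m [n [n0 cop ->]]] := rat_zq y => e.
have n0' : zq n != 0 by apply: zq_neq0; lia.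
have {e} e : (m * m = k * (n * n))%BZ.
  apply: zq_inj; rewrite !zqM -e; field; exact: n0'.
suff -> : n = 1%BZ by exists m; rewrite zq1 divr1.
have : (n | m)%BZ.
  apply: (Gauss _ m); first by exists (k * n)%BZ; lia.
  by apply/rel_prime_sym/Zgcd_1_rel_prime.
move=> nm; have : (n | Z.gcd m n)%BZ by apply: Z.gcd_greatest => //; exists 1%BZ; lia.
by rewrite cop => /Z.divide_1_r_nonneg; lia.
Qed.

(** Abscissas of the affine rational points of y^2 = x(x^2 + ax + b). The quotient of this curve by
    (0, 0) has the coefficients -2a and a^2 - 4b. *)
Definition on_curve (a b : Z) (x : rat) : Prop :=
  exists y : rat, y ^+ 2 = x * (x ^+ 2 + zq a * x + zq b).

Arguments on_curve (a b)%_BZ x.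

(** Clearing denominators gives a square [n * c] with [c] coprime to the denominator [n], so [n] is
    itself a square by [gcd_of_square]. *)
Lemma on_curve_frac a b (x : rat) : x != 0 -> on_curve a b x ->
  exists m q s : Z, [/\ (0 < q)%BZ, m <> 0%BZ, Z.gcd m q = 1%BZ,
    x = zq m / (zq q ^+ 2) &
    (m * (m * m + a * m * (q * q) + b * (q * q * (q * q))) = s * s)%BZ].
Proof.
move=> x0 [y ey]; have [m [n [n0 cop ex]]] := rat_zq x.
have n0' : zq n != 0 by apply: zq_neq0; lia.
have m0 : m <> 0%BZ by move=> h; case/eqP: x0; rewrite ex h zq0 mul0r.
have [s es] : exists s, y * zq n ^+ 2 = zq s.
  apply: (@zq_sqrt _ (n * (m * (m * m + a * m * n + b * (n * n))))%BZ).
  rewrite !(zqM, zqD) exprMn ey ex; field; exact: n0'.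
have {es} es : (n * (m * (m * m + a * m * n + b * (n * n))) = s * s)%BZ.
  apply: zq_inj; rewrite !(zqM, zqD) -es; move: ey; rewrite ex.
  rewrite -[y * _ * _]/(_ * _) => ey.
  have -> : y * zq n ^+ 2 * (y * zq n ^+ 2) = y ^+ 2 * zq n ^+ 4 by ring.
  rewrite ey; field; exact: n0'.
have copn : Z.gcd n (m * (m * m + a * m * n + b * (n * n))) = 1%BZ.
  apply: Zgcd1M; first by rewrite Z.gcd_comm.
  have -> : (m * m + a * m * n + b * (n * n) = m * m + (a * m + b * n) * n)%BZ by lia.
  by rewrite Z.gcd_add_mult_diag_r; apply: Zgcd1M; rewrite Z.gcd_comm.
have := gcd_of_square es; rewrite copn Z.mul_1_r => en.
have q0 := Z.gcd_nonneg n s.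
set q := Z.gcd n s in en q0.
have {}en : n = (q * q)%BZ by lia.
have q1 : (0 < q)%BZ by nia.
have [s' es'] : (q | s)%BZ by exact: Z.gcd_divide_r.
exists m, q, s'; split=> //.
- have : Z.gcd m (q * q) = 1%BZ by rewrite -en.
  move=> h; have [d1 d2] := (Z.gcd_divide_l m q, Z.gcd_divide_r m q).
  have : (Z.gcd m q | Z.gcd m (q * q))%BZ.
    by apply: Z.gcd_greatest => //; apply: Z.divide_mul_l.
  by rewrite h => /Z.divide_1_r_nonneg; have := Z.gcd_nonneg m q; lia.
- by rewrite ex en zqM.
- rewrite en in es; apply: (Z.mul_reg_l _ _ (q * q)); first by nia.
  rewrite -[in RHS]/(_ * _)%BZ es es'; nia.
Qed.

(** The common divisor [d] of [m] and the quadratic factor divides b q^4 and is coprime to [q],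
    hence divides [b]; and |m| d is a square by [gcd_of_square]. Thus only finitely many square
    classes occur. *)
Lemma on_curve_square a b (x : rat) : b <> 0%BZ -> x != 0 -> on_curve a b x ->
  exists (d : Z) (u : rat), [/\ (0 < d)%BZ, (d | b)%BZ &
    x = zq d * u ^+ 2 \/ x = - (zq d * u ^+ 2)].
Proof.
move=> b0 x0 /on_curve_frac [] // m [q [s [q0 m0 cop -> es]]].
have := gcd_of_square es.
set k := (_ + _)%BZ; set d := Z.gcd m k.
move=> e.
have db : (d | b)%BZ.
  have d1 : (d | m)%BZ by apply: Z.gcd_divide_l.
  have d2 : (d | b * (q * q * (q * q)))%BZ.
    have -> : (b * (q * q * (q * q)) = k - m * (m + a * (q * q)))%BZ by rewrite /k; lia.
    apply: Z.divide_sub_r; first exact: Z.gcd_divide_r.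
    exact: Z.divide_mul_l.
  have cdq : rel_prime d (q * q * (q * q)).
    have h : rel_prime d q.
      apply/Zgcd_1_rel_prime; have : (Z.gcd d q | Z.gcd m q)%BZ.
        apply: Z.gcd_greatest; last exact: Z.gcd_divide_r.
        by apply: Z.divide_trans d1; apply: Z.gcd_divide_l.
      by rewrite cop => /Z.divide_1_r_nonneg; have := Z.gcd_nonneg d q; lia.
    by do ! apply: rel_prime_mult.
  by apply: (Gauss _ (q * q * (q * q))); rewrite 1?Z.mul_comm.
have d0 : (0 < d)%BZ.
  have : d <> 0%BZ by move=> /Z.gcd_eq_0_l.
  by have := Z.gcd_nonneg m k; rewrite -/d; lia.
exists d, (zq (Z.gcd m s) / (zq d * zq q)); split=> //.
have dq0 : zq d != 0 by apply: zq_neq0; lia.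
have qq0 : zq q != 0 by apply: zq_neq0; lia.
have -> : zq d * (zq (Z.gcd m s) / (zq d * zq q)) ^+ 2
        = zq (Z.gcd m s * Z.gcd m s) / (zq d * zq q ^+ 2).
  by rewrite zqM; field; rewrite dq0 qq0.
rewrite e zqM -/d.
by case: (Z.abs_eq_or_opp m) => ->; [left | right]; rewrite ?zqN; field; rewrite dq0 qq0.
Qed.

(** If [m] and [n] agree up to the factor 2 + |a| + |b|, their product is large enough; otherwise
    the square of the larger one dominates the quadratic form. *)
Lemma height_shift_le a b m n : b <> 0%BZ ->
  (Z.max (Z.abs m) (Z.abs n) * Z.max (Z.abs m) (Z.abs n) <=
   (2 + Z.abs a + Z.abs b) *
     Z.max (Z.abs (m * m + a * m * n + b * (n * n))) (Z.abs (m * n)))%BZ.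
Proof.
move=> b0; set A := (m * m + _ + _)%BZ; set K := (2 + _ + _)%BZ.
have [K1 b1] : (0 < K /\ 1 <= Z.abs b)%BZ by rewrite /K; lia.
have am : (Z.abs (a * m * n) = Z.abs a * Z.abs m * Z.abs n)%BZ.
  by rewrite !Z.abs_mul.
have bn : (Z.abs (b * (n * n)) = Z.abs b * (Z.abs n * Z.abs n))%BZ.
  by rewrite !Z.abs_mul.
have mm : (m * m = Z.abs m * Z.abs m)%BZ by rewrite Z.abs_square.
have mn := Z.abs_mul m n.
have A1 : (m * m - Z.abs (a * m * n) - Z.abs (b * (n * n)) <= Z.abs A)%BZ.
  by rewrite /A; move: (m * m)%BZ (a * m * n)%BZ (b * (n * n))%BZ; clear; lia.
have A2 : (Z.abs (b * (n * n)) - Z.abs (a * m * n) - m * m <= Z.abs A)%BZ.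
  rewrite /A; have : (0 <= m * m)%BZ by rewrite mm -Z.abs_mul; apply: Z.abs_nonneg.
  by move: (m * m)%BZ (a * m * n)%BZ (b * (n * n))%BZ; clear; lia.
rewrite mn; rewrite am bn mm in A1 A2; clear am bn mm mn.
move: (Z.abs A) A1 A2 => A'; clear A.
have := Z.abs_nonneg m; have := Z.abs_nonneg n; have := Z.abs_nonneg a.
move: (Z.abs m) (Z.abs n) (Z.abs a) (Z.abs b) b1 @K K1 => M N a' b' b1 K K1.
move=> a0 N0 M0 A1 A2.
suff [h|h] : (Z.max M N * Z.max M N <= K * A' \/
              Z.max M N * Z.max M N <= K * (M * N))%BZ by nia.
have [NM|MN] := Z_le_gt_dec N M.
  rewrite Z.max_l //; have [h|h] := Z_le_gt_dec M (N * K); first by right; nia.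
  left; have h1 : (a' * M * (N * K) <= a' * M * M)%BZ by nia.
  have h2 : (b' * N * (N * K) <= b' * N * M)%BZ by nia.
  have h3 : (b' * N * M <= b' * M * M)%BZ by nia.
  have h4 : (K * (M * M - a' * M * N - b' * (N * N)) <= K * A')%BZ.
    by apply: Z.mul_le_mono_nonneg_l; [apply: Z.lt_le_incl |].
  have h5 : (K * (M * M) = 2 * (M * M) + a' * M * M + b' * M * M)%BZ.
    by rewrite /K; clear; lia.
  have : (0 <= M * M)%BZ by apply: Z.mul_nonneg_nonneg.
  move: h1 h2 h3 h4 h5; clear; lia.
rewrite Z.max_r; last by lia.
have [h|h] := Z_le_gt_dec N (M * K); first by right; nia.
left; have h1 : (a' * N * (M * K) <= a' * N * N)%BZ by nia.
have h2 : (M * (M * K) <= M * N)%BZ by nia.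
have h3 : (M * N <= N * N)%BZ by nia.
have h4 : (K * (b' * (N * N) - a' * M * N - M * M) <= K * A')%BZ.
  by apply: Z.mul_le_mono_nonneg_l; [apply: Z.lt_le_incl |].
have h5 : (K * (N * N) <= K * b' * (N * N))%BZ.
  apply: Z.mul_le_mono_nonneg_r; first by apply: Z.mul_nonneg_nonneg.
  by move: K1 b1; clear; nia.
have h6 : (K * (N * N) = 2 * (N * N) + a' * N * N + b' * (N * N))%BZ.
  by rewrite /K; clear; lia.
have h7 : (0 <= b' * (N * N))%BZ.
  apply: Z.mul_nonneg_nonneg; first by move: b1; clear; lia.
  exact: Z.mul_nonneg_nonneg.
move: h1 h2 h3 h4 h5 h6 h7; clear; lia.
Qed.

(** Here x + a + b/x = y^2/x^2 is the abscissa of the image under the 2-isogeny, which thus squares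
    heights up to a constant. Cancellation costs at most |b|: a common divisor of the numerator and
    [m * n] is coprime to [n], hence divides [m], and then [b]. *)
Lemma height_isog a b (x : rat) : b <> 0%BZ -> x != 0 ->
  (height x * height x <=
   (2 + Z.abs a + Z.abs b) * Z.abs b * height (x + zq a + zq b / x))%BZ.
Proof.
move=> b0 x0; have [m [n [n0 cop ex]]] := rat_zq x.
have n0' : zq n != 0 by apply: zq_neq0; lia.
have m0 : m <> 0%BZ by move=> h; case/eqP: x0; rewrite ex h zq0 mul0r.
have m0' : zq m != 0 by apply: zq_neq0.
have hx : height x = Z.max (Z.abs m) (Z.abs n).
  rewrite -(@height_frac m n); last by lia.
  by rewrite -ex cop; lia.
have := @height_shift_le a b m n b0; rewrite -hx => hs.
set A := (m * m + _ + _)%BZ in hs.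
have mn0 : (m * n)%BZ <> 0%BZ by apply/Z.neq_mul_0; split=> //; lia.
have := @height_frac A (m * n) mn0.
have -> : zq A / zq (m * n) = x + zq a + zq b / x.
  rewrite ex /A !(zqM, zqD); field; by rewrite n0'.
move=> e; rewrite -e in hs.
apply: (Z.le_trans _ _ _ hs).
suff : (Z.gcd A (m * n) <= Z.abs b)%BZ.
  have := height_gt0 (x + zq a + zq b / x); move: (height _) => h h0 gb.
  have hg : (h * Z.gcd A (m * n) <= Z.abs b * h)%BZ.
    by rewrite (Z.mul_comm _ h); apply: Z.mul_le_mono_nonneg_l => //; exact: Z.lt_le_incl.
  rewrite -Z.mul_assoc; apply: Z.mul_le_mono_nonneg_l => //; clear; lia.
apply: Z.divide_pos_le; first by lia.
apply/Z.divide_abs_r.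
have Dn : rel_prime (Z.gcd A (m * n)) n.
  apply: (@rel_prime_div A); last exact: Z.gcd_divide_l.
  apply/Zgcd_1_rel_prime; rewrite Z.gcd_comm.
  have -> : A = (m * m + (a * m + b * n) * n)%BZ by rewrite /A; lia.
  by rewrite Z.gcd_add_mult_diag_r; apply: Zgcd1M; rewrite Z.gcd_comm.
have Dm : (Z.gcd A (m * n) | m)%BZ.
  by apply: (Gauss _ n) => //; rewrite Z.mul_comm; apply: Z.gcd_divide_r.
apply: (Gauss _ n) => //; apply: (Gauss _ n) => //.
have -> : (n * (n * b) = A - m * (m + a * n))%BZ by rewrite /A; lia.
apply: Z.divide_sub_r; first exact: Z.gcd_divide_l.
exact: Z.divide_mul_l.
Qed.

(** * Descent by 2-isogeny *)

Lemma Zabs_linear_le al be m n C h : (Z.abs al + Z.abs be <= C)%BZ ->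
  (Z.abs m <= h)%BZ -> (Z.abs n <= h)%BZ -> (Z.abs (al * m + be * n) <= C * h)%BZ.
Proof.
move=> hC hm hn; have h0 : (0 <= h)%BZ by move: hm; clear; lia.
apply: Z.le_trans (Z.abs_triangle _ _) _; rewrite !Z.abs_mul.
apply: (Z.le_trans _ ((Z.abs al + Z.abs be) * h)); last exact: Z.mul_le_mono_nonneg_r.
rewrite Z.mul_add_distr_r; apply: Z.add_le_mono;
  apply: Z.mul_le_mono_nonneg_l => //; exact: Z.abs_nonneg.
Qed.

(** Translation by a 2-torsion point acts on abscissas by a Moebius map; this bounds its effect on
    the height. *)
Lemma height_mobius_le (al be ga de C : Z) (x : rat) :
  (Z.abs al + Z.abs be <= C)%BZ -> (Z.abs ga + Z.abs de <= C)%BZ ->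
  zq ga * x + zq de != 0 ->
  (height ((zq al * x + zq be) / (zq ga * x + zq de)) <= C * height x)%BZ.
Proof.
have [m [n [n0 cop ex]]] := rat_zq x => h1 h2.
have n0' : zq n != 0 by apply: zq_neq0; lia.
have -> : zq al * x + zq be = zq (al * m + be * n) / zq n.
  by rewrite ex !(zqD, zqM); field.
have -> : zq ga * x + zq de = zq (ga * m + de * n) / zq n.
  by rewrite ex !(zqD, zqM); field.
rewrite mulf_eq0 zq_eq0 invr_eq0 negb_or => /andP [/eqP d0 _].
have -> : zq (al * m + be * n) / zq n / (zq (ga * m + de * n) / zq n) =
    zq (al * m + be * n) / zq (ga * m + de * n).
  by field; rewrite n0' zq_neq0.
have := @height_frac (al * m + be * n) _ d0.
have := @height_frac m n; rewrite -ex cop => /(_ ltac:(lia)).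
have := height_gt0 (zq (al * m + be * n) / zq (ga * m + de * n)).
move: (height _) (height x) => H h; rewrite Z.mul_1_r => H0 eh eH.
have hm : (Z.abs m <= h)%BZ by lia.
have hn : (Z.abs n <= h)%BZ by lia.
have g1 : (1 <= Z.gcd (al * m + be * n) (ga * m + de * n))%BZ.
  have := Z.gcd_nonneg (al * m + be * n) (ga * m + de * n).
  have : Z.gcd (al * m + be * n) (ga * m + de * n) <> 0%BZ by move=> /Z.gcd_eq_0_r.
  lia.
have b1 := Zabs_linear_le h1 hm hn.
have b2 := Zabs_linear_le h2 hm hn.
apply: (Z.le_trans _ (H * Z.gcd (al * m + be * n) (ga * m + de * n))).
  rewrite -{1}(Z.mul_1_r H); apply: Z.mul_le_mono_nonneg_l => //.
  exact: Z.lt_le_incl.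
by rewrite eH; apply: Z.max_lub.
Qed.

(* The composite of the two 2-isogenies is multiplication by 2, so a point with
   abscissa [u ^+ 2] is twice a point with abscissa [x1], up to 2-torsion. *)
Lemma square_halving a b (u : rat) : (a * a - 4 * b)%BZ <> 0%BZ -> b <> 0%BZ ->
  (forall x : rat, x != 0 -> on_curve (- (2 * a)) (a * a - 4 * b) x ->
     exists s : rat, x = s ^+ 2 \/ x * s ^+ 2 = zq (a * a - 4 * b)) ->
  u != 0 -> on_curve a b (u ^+ 2) ->
  exists x1 s : rat, [/\ x1 != 0, s != 0, on_curve a b x1,
    s ^+ 2 = x1 + zq a + zq b / x1 &
    4 * u ^+ 2 = s ^+ 2 + zq (- (2 * a)) + zq (a * a - 4 * b) / s ^+ 2].
Proof.
move=> d0 b0 S' u0 [y ey].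
have zd0 := zq_neq0 d0; have zb0 := zq_neq0 b0.
set v := y / u.
have ev : v ^+ 2 = (u ^+ 2) ^+ 2 + zq a * u ^+ 2 + zq b.
  by rewrite /v expr_div_n ey; field.
(* The abscissas of the two preimages under the dual isogeny X -> (X - 2a + b'/X)/4, with b' = a^2 -
   4b. Their product is b', so [S'] makes one of them the square s^2. *)
set x' := zq a + 2 * u ^+ 2 + 2 * v.
set x'' := zq a + 2 * u ^+ 2 - 2 * v.
have z2 : zq 2 = 2 by rewrite zqE.
have z4 : zq 4 = 4 by rewrite zqE.
have ed : zq (a * a - 4 * b) = zq a ^+ 2 - 4 * zq b.
  by rewrite zqB !zqM z4; ring.
have xx : x' * x'' = zq (a * a - 4 * b).
  rewrite ed /x' /x''.
  have -> : (zq a + 2 * u ^+ 2 + 2 * v) * (zq a + 2 * u ^+ 2 - 2 * v) =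
    (zq a + 2 * u ^+ 2) ^+ 2 - 4 * v ^+ 2 by ring.
  by rewrite ev; ring.
have x'0 : x' != 0 by apply: contra_neq zd0 => h; rewrite -xx h mul0r.
have [|s hs] := S' x' x'0.
  exists (2 * u * x'); rewrite -xx zqN zqM z2 /x' /x''; ring.
have s0 : s != 0.
  apply/eqP => h; case: hs => hs.
    by case/eqP: x'0; rewrite hs h expr0n.
  by case/eqP: zd0; rewrite -hs h expr0n mulr0.
have e4 : 4 * u ^+ 2 = s ^+ 2 + zq (- (2 * a)) + zq (a * a - 4 * b) / s ^+ 2.
  have : (s ^+ 2 = x' /\ zq (a * a - 4 * b) / s ^+ 2 = x'') \/
         (s ^+ 2 = x'' /\ zq (a * a - 4 * b) / s ^+ 2 = x').
    case: hs => hs; [left | right].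
      by rewrite -xx -hs; split=> //; field.
    have es : s ^+ 2 = x'' by apply: (mulfI x'0); rewrite hs xx.
    split=> //; rewrite -hs; field; exact: s0.
  by case=> -[-> ->]; rewrite zqN zqM z2 /x' /x''; ring.
(* The preimages under the first isogeny: the roots of X^2 + (a - s^2) X + b, whose discriminant is
   (2us)^2. *)
set x1 := (s ^+ 2 - zq a + 2 * u * s) / 2.
set x2 := (s ^+ 2 - zq a - 2 * u * s) / 2.
have x12 : x1 * x2 = zq b.
  have -> : x1 * x2 = ((s ^+ 2 - zq a) ^+ 2 - 4 * u ^+ 2 * s ^+ 2) / 4.
    by rewrite /x1 /x2; field.
  by rewrite e4 ed zqN zqM z2; field.
have x10 : x1 != 0 by apply: contra_neq zb0 => h; rewrite -x12 h mul0r.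
have es : s ^+ 2 = x1 + zq a + zq b / x1.
  rewrite -x12 mulrC mulKf //.
  by rewrite /x1 /x2; field.
exists x1, s; split=> //.
by exists (s * x1); rewrite exprMn es; field.
Qed.

(** [S] replaces x by a square, which [square_halving] halves to x1 with h(x1)^4 <= M1^2 M2 (4C)
    h(x), where M1 and M2 are the constants of [height_isog] for the two isogenies. The last bound
    makes the constant at most B^3, so h(x1) < h(x) as soon as h(x) > B. Membership in [L] then
    returns from x1 to the square by [close], and from the square to x by the last clause of [S]. *)
Lemma descent (a b C B : Z) (L : seq Z) :
  let b' := (a * a - 4 * b)%BZ in
  b <> 0%BZ -> b' <> 0%BZ ->
  (forall x : rat, x != 0 -> on_curve a b x -> x \in map zq L \/
     exists u : rat, [/\ u != 0, on_curve a b (u ^+ 2),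
       (height (u ^+ 2) <= C * height x)%BZ &
       u ^+ 2 \in map zq L -> x \in map zq L]) ->
  (forall x : rat, x != 0 -> on_curve (- (2 * a)) b' x ->
     exists s : rat, x = s ^+ 2 \/ x * s ^+ 2 = zq b') ->
  (forall (l : Z) (u s : rat), l \in L -> u != 0 -> s != 0 ->
     s ^+ 2 = zq l + zq a + zq b / zq l ->
     4 * u ^+ 2 = s ^+ 2 + zq (- (2 * a)) + zq b' / s ^+ 2 ->
     u ^+ 2 \in map zq L) ->
  (forall x : rat, x != 0 -> on_curve a b x -> (height x <= B)%BZ ->
     x \in map zq L) ->
  (0 < B)%BZ ->
  (((2 + Z.abs a + Z.abs b) * Z.abs b) * ((2 + Z.abs a + Z.abs b) * Z.abs b) *
     ((2 + Z.abs (- (2 * a)) + Z.abs b') * Z.abs b') * (4 * C) <= B * B * B)%BZ ->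
  forall x : rat, x != 0 -> on_curve a b x -> x \in map zq L.
Proof.
move=> b' b0 b'0 S S' close search B0 const x.
have [n] := ubnP (Z.to_nat (height x)); elim: n x => // n IH x hn x0 cx.
have [hB|hB] := Z_le_gt_dec (height x) B; first exact: search.
case: (S x x0 cx) => // -[u [u0 cu hu back]].
have [x1 [s [x10 s0 cx1 es eu]]] := square_halving b'0 b0 S' u0 cu.
have h1 := @height_isog a b x1 b0 x10; rewrite -es in h1.
have s20 : s ^+ 2 != 0 by rewrite expf_neq0.
have h2 := @height_isog (- (2 * a)) b' (s ^+ 2) b'0 s20; rewrite -eu in h2.
have h3 : (height (4 * u ^+ 2) <= 4 * height (u ^+ 2))%BZ.
  have := @height_mobius_le 4 0 0 1 4 (u ^+ 2).
  have -> : zq 4 = 4 by rewrite zqE.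
  by rewrite zq0 zq1 mul0r add0r addr0 divr1; apply; rewrite ?oner_neq0.
apply: back.
have [g0 g1 g2] := And3 (height_gt0 x1) (height_gt0 x) (height_gt0 (s ^+ 2)).
have [lt|ge] := Z_lt_le_dec (height x1) (height x).
  have : x1 \in map zq L by apply: IH => //; lia.
  by move=> /mapP [l lL el]; apply: (close l u s) => //; rewrite -el.
exfalso; move: (height x1) (height x) (height (s ^+ 2)) h1 h2 g0 g1 g2 ge hB hu h3.
move=> p q r h1 h2 p0 q0 r0 pq qB hu h3.
set M1 := ((2 + Z.abs a + Z.abs b) * Z.abs b)%BZ in h1 const.
set M2 := ((2 + Z.abs (- (2 * a)) + Z.abs b') * Z.abs b')%BZ in h2 const.
have M10 : (0 <= M1)%BZ.
  by apply: Z.mul_nonneg_nonneg; [apply: Z.add_nonneg_nonneg |]; clear; lia.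
have M20 : (0 <= M2)%BZ.
  by apply: Z.mul_nonneg_nonneg; [apply: Z.add_nonneg_nonneg |]; clear; lia.
clearbody M1 M2.
have k1 : (r * r <= M2 * (4 * C) * q)%BZ.
  apply: (Z.le_trans _ _ _ h2); rewrite -Z.mul_assoc.
  by apply: Z.mul_le_mono_nonneg_l => //; lia.
have k2 : (p * p * (p * p) <= (M1 * M1) * (r * r))%BZ.
  have -> : (M1 * M1 * (r * r) = (M1 * r) * (M1 * r))%BZ by lia.
  by apply: Z.mul_le_mono_nonneg => //; nia.
have k3 : (p * p * (p * p) <= B * B * B * q)%BZ.
  apply: (Z.le_trans _ _ _ k2).
  apply: (Z.le_trans _ (M1 * M1 * (M2 * (4 * C) * q))).
    by apply: Z.mul_le_mono_nonneg_l => //; nia.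
  have -> : (M1 * M1 * (M2 * (4 * C) * q) = M1 * M1 * M2 * (4 * C) * q)%BZ by lia.
  by apply: Z.mul_le_mono_nonneg_r => //; lia.
have k4 : (q * q * (q * q) <= p * p * (p * p))%BZ.
  by apply: Z.mul_le_mono_nonneg; nia.
have k5 : (q * q * q * q <= B * B * B * q)%BZ.
  by apply: Z.le_trans k3; apply: Z.le_trans k4; rewrite !Z.mul_assoc; lia.
have {}k5 : (q * q * q <= B * B * B)%BZ by apply/(Z.mul_le_mono_pos_r _ _ q); lia.
have k6 : (B * B <= q * q)%BZ by apply: Z.mul_le_mono_nonneg; lia.
have k7 : (B * B * B <= q * q * B)%BZ by apply: Z.mul_le_mono_nonneg_r; lia.
have k8 : (q * q * B < q * q * q)%BZ by apply: Zmult_lt_compat_l; [apply: Z.mul_pos_pos|]; lia.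
lia.
Qed.

Definition zsquare (z : Z) : bool := Z.eqb (Z.sqrt z * Z.sqrt z) z.

Lemma zsquareP s : zsquare (s * s).
Proof.
rewrite /zsquare; have -> : (s * s = Z.abs s * Z.abs s)%BZ by lia.
by rewrite Z.sqrt_square ?Z.eqb_refl //; lia.
Qed.

Fixpoint zall (f : Z -> bool) (lo : Z) (n : nat) : bool :=
  if n is n'.+1 then f lo && zall f (Z.succ lo) n' else true.

Lemma zallP f lo n x : zall f lo n -> (lo <= x < lo + Z.of_nat n)%BZ -> f x.
Proof.
elim: n lo => [|n IH] lo /=; first by lia.
case/andP => f0 /IH h hx; have [->//|ne] := Z.eq_dec x lo.
by apply: h; lia.
Qed.

(** At x = d p^2 / q^2 the number tested for being a square is (y q^3 / p)^2. *)
Definition search (a b : Z) (D L : seq Z) (Q : nat) : bool :=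
  all (fun d => zall (fun p => zall (fun q =>
    let p2 := (d * (p * p))%BZ in let q2 := (q * q)%BZ in
    zsquare (d * (p2 * p2 + a * (p2 * q2) + b * (q2 * q2))) ==>
    has (fun l => Z.eqb p2 (l * q2)) L) 1 Q) 1 Q) D.

(** For x = d p^2 / q^2 with p and q coprime, at most |d| cancels, so p^2 and q^2 are at most |d| B
    and the box of side [Q] contains (p, q). *)
Lemma search_sound a b (D L : seq Z) B (Q : nat) :
  search a b D L Q ->
  (forall d, d \in D -> d <> 0%BZ /\
     (Z.abs d * B < (Z.of_nat Q + 1) * (Z.of_nat Q + 1))%BZ) ->
  (forall x : rat, x != 0 -> on_curve a b x ->
     exists (d : Z) (u : rat), d \in D /\ x = zq d * u ^+ 2) ->
  forall x : rat, x != 0 -> on_curve a b x -> (height x <= B)%BZ -> x \in map zq L.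
Proof.
move=> /allP hs hD hx x x0 cx hB.
have [d [u [dD ex]]] := hx x x0 cx; have [d0 dB] := hD d dD.
have [m [q [q0 cop eu]]] := rat_zq u.
have {m cop eu}[p [p0 cop eu]] : exists p, [/\ (0 < p)%BZ, Z.gcd p q = 1%BZ &
    u ^+ 2 = zq p ^+ 2 / zq q ^+ 2].
  have m0 : m <> 0%BZ.
    by move=> h; case/eqP: x0; rewrite ex eu h zq0 mul0r expr0n mulr0.
  exists (Z.abs m); split; [by lia | by rewrite Z.gcd_abs_l |].
  by rewrite eu expr_div_n; case: (Z.abs_eq_or_opp m) => ->; rewrite ?zqN ?sqrrN.
have p0' : zq p != 0 by apply: zq_neq0; lia.
have q0' : zq q != 0 by apply: zq_neq0; lia.
have d0' : zq d != 0 by apply: zq_neq0.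
have ex' : x = zq (d * (p * p)) / zq (q * q).
  by rewrite ex eu !zqM; field.
have hgt := @height_frac (d * (p * p)) (q * q) ltac:(nia).
rewrite -ex' in hgt.
have gd : (Z.gcd (d * (p * p)) (q * q) <= Z.abs d)%BZ.
  apply: Z.divide_pos_le; first by lia.
  apply/Z.divide_abs_r.
  have rp : rel_prime (q * q) (p * p).
    apply/Zgcd_1_rel_prime/Zgcd1M; rewrite Z.gcd_comm; apply: Zgcd1M; exact: cop.
  apply: (Gauss _ (p * p)).
    by rewrite Z.mul_comm; apply: Z.gcd_divide_l.
  by apply: (rel_prime_div _ _ _ rp); apply: Z.gcd_divide_r.
have hmax : (Z.max (Z.abs d * (p * p)) (q * q) < (Z.of_nat Q + 1) * (Z.of_nat Q + 1))%BZ.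
  have := height_gt0 x; have := Z.gcd_nonneg (d * (p * p)) (q * q).
  move: (Z.gcd _ _) (height x) gd hgt hB => g h gd hgt hB g0 h0.
  have : (h * g <= B * Z.abs d)%BZ by apply: Z.mul_le_mono_nonneg; lia.
  nia.
have pQ : (1 <= p < 1 + Z.of_nat Q)%BZ by nia.
have qQ : (1 <= q < 1 + Z.of_nat Q)%BZ by nia.
have := zallP (zallP (hs d dD) pQ) qQ; move=> /=; set e := (d * (_ + _))%BZ.
have [y ey] := cx.
have [s es] : exists s, y * zq q ^+ 3 / zq p = zq s.
  apply: (@zq_sqrt _ e).
  rewrite expr_div_n exprMn ey ex' /e !(zqD, zqM); field; by rewrite p0'.
have -> : e = (s * s)%BZ.
  apply: zq_inj; rewrite [in RHS]zqM -es -expr2 expr_div_n exprMn ey ex' /e.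
  rewrite !(zqD, zqM); field; by rewrite p0'.
rewrite zsquareP => /hasP [l lL /Z.eqb_eq el].
apply/mapP; exists l => //; rewrite ex' el !zqM; field; exact: q0'.
Qed.

Lemma Zodd_square z : Z.odd z -> exists k, (z * z = 8 * k + 1)%BZ.
Proof.
case/Z.odd_spec => t ->.
have : Z.even (t * (t + 1)).
  by rewrite Z.even_mul Z.even_add; case: (Z.even t).
case/Z.even_spec => k ek; exists k; nia.
Qed.

Lemma Zsquare_mod4 z : exists k, (z * z = 4 * k)%BZ \/ (z * z = 4 * k + 1)%BZ.
Proof.
case e: (Z.odd z).
  by have [k ek] := Zodd_square e; exists (2 * k)%BZ; right; lia.
have : Z.even z by rewrite -Z.negb_odd e.
by case/Z.even_spec => t ->; exists (t * t)%BZ; left; lia.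
Qed.

(* At [u = p / q] in lowest terms, [q ^ 4] times the right-hand side is 12
   modulo 16 if [p] and [q] are odd, and 3 modulo 4 otherwise. *)
Lemma quartic_not_square (A B C : Z) (u w : rat) :
  (A mod 4 = 3)%BZ -> (C mod 4 = 3)%BZ -> (B mod 2 = 0)%BZ ->
  ((A + B + C) mod 16 = 12)%BZ ->
  w ^+ 2 <> zq A * u ^+ 4 + zq B * u ^+ 2 + zq C.
Proof.
move=> hA hC hB hS ew; have [p [q [q0 cop eu]]] := rat_zq u.
have q0' : zq q != 0 by apply: zq_neq0; lia.
have [s es] : exists s : Z, w * zq q ^+ 2 = zq s.
  apply: (@zq_sqrt _ (A * (p * p * (p * p)) + B * (p * p) * (q * q) + C * (q * q * (q * q)))%BZ).
  by rewrite exprMn ew eu !(zqD, zqM); field.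
have {es} : (s * s = A * (p * p * (p * p)) + B * (p * p) * (q * q) + C * (q * q * (q * q)))%BZ.
  apply: zq_inj; rewrite [in LHS]zqM -es -expr2 exprMn ew eu !(zqD, zqM); field; exact: q0'.
have [al eA] : exists k, (A = 4 * k + 3)%BZ by exists (A / 4)%BZ; have := Z.div_mod A 4; lia.
have [ga eC] : exists k, (C = 4 * k + 3)%BZ by exists (C / 4)%BZ; have := Z.div_mod C 4; lia.
have [be eB] : exists k, (B = 2 * k)%BZ by exists (B / 2)%BZ; have := Z.div_mod B 2; lia.
have [de eS] : exists k, (A + B + C = 16 * k + 12)%BZ.
  by exists ((A + B + C) / 16)%BZ; have := Z.div_mod (A + B + C) 16; lia.
have not3 X z : (z * z <> 4 * X + 3)%BZ.
  by have [k [->|->]] := Zsquare_mod4 z; lia.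
case ep: (Z.odd p); case eq: (Z.odd q) => es.
- have [k ek] := Zodd_square ep; have [l el] := Zodd_square eq.
  rewrite ek el in es.
  pose X := (de + A * (4 * k * k + k) + be * (8 * k * l + k + l) +
             C * (4 * l * l + l))%BZ.
  have {}es : (s * s = 16 * X + 12)%BZ by rewrite es /X; nia.
  case e: (Z.odd s); first by have [j ej] := Zodd_square e; lia.
  have : Z.even s by rewrite -Z.negb_odd e.
  by case/Z.even_spec => r er; apply: (not3 X r); nia.
- have /Z.even_spec [r er] : Z.even q by rewrite -Z.negb_odd eq.
  have [k ek] := Zodd_square ep; apply: (not3 (al + A * (16 * k * k + 4 * k) +
     B * (8 * k + 1) * r * r + 4 * C * r * r * r * r)%BZ s).
  rewrite es ek er eA; ring.
- have /Z.even_spec [r er] : Z.even p by rewrite -Z.negb_odd ep.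
  have [k ek] := Zodd_square eq; apply: (not3 (ga + C * (16 * k * k + 4 * k) +
     B * (8 * k + 1) * r * r + 4 * A * r * r * r * r)%BZ s).
  rewrite es ek er eC; ring.
- have /Z.even_spec [r er] : Z.even q by rewrite -Z.negb_odd eq.
  have /Z.even_spec [t et] : Z.even p by rewrite -Z.negb_odd ep.
  have : (2 | Z.gcd p q)%BZ.
    by apply: Z.gcd_greatest; [exists t | exists r]; lia.
  by rewrite cop => /Z.divide_1_r_nonneg; lia.
Qed.

(** * The four curves *)

(** The sign is kept apart: where the quadratic factor is positive, a negative abscissa is excluded
    over the reals. *)
Lemma on_curve_class a b (D : seq Z) (x : rat) : b <> 0%BZ ->
  zall (fun d => Z.eqb (Z.abs b mod d) 0 ==> (d \in D)) 1 (Z.to_nat (Z.abs b)) ->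
  x != 0 -> on_curve a b x ->
  exists (d : Z) (u : rat), [/\ d \in D, u != 0 & x = zq d * u ^+ 2 \/ x = - (zq d * u ^+ 2)].
Proof.
move=> b0 hD x0 cx; have [d [u [d0 db ex]]] := on_curve_square b0 x0 cx.
have d'b : (d | Z.abs b)%BZ by apply/Z.divide_abs_r.
have dle : (1 <= d < 1 + Z.of_nat (Z.to_nat (Z.abs b)))%BZ.
  rewrite Z2Nat.id; last exact: Z.abs_nonneg.
  by have := Z.divide_pos_le d (Z.abs b) ltac:(lia) d'b; lia.
exists d, u; split=> //.
  by have := zallP hD dle; rewrite (Zdivide_mod _ _ d'b).
apply: contra_neq x0 => h.
by case: ex => ->; rewrite h expr0n mulr0 ?oppr0.
Qed.

Lemma sqr_gt0 (u : rat) : u != 0 -> 0 < u ^+ 2.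
Proof. by move=> u0; rewrite lt_def sqrf_eq0 u0 sqr_ge0. Qed.

(** The hypothesis [S] of [descent] at one abscissa; in use, u^2 is x or its translate by a
    2-torsion point. *)
Definition square_step a b C (L : seq Z) (x : rat) : Prop :=
  x \in map zq L \/ exists u : rat, [/\ u != 0, on_curve a b (u ^+ 2),
    (height (u ^+ 2) <= C * height x)%BZ &
    u ^+ 2 \in map zq L -> x \in map zq L].

Lemma descent_step a b C (L : seq Z) al be ga de (x u y : rat) :
  u ^+ 2 = (zq al * x + zq be) / (zq ga * x + zq de) ->
  (Z.abs al + Z.abs be <= C)%BZ -> (Z.abs ga + Z.abs de <= C)%BZ ->
  u != 0 -> zq ga * x + zq de != 0 ->
  y ^+ 2 = u ^+ 2 * ((u ^+ 2) ^+ 2 + zq a * u ^+ 2 + zq b) ->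
  (u ^+ 2 \in map zq L -> x \in map zq L) ->
  square_step a b C L x.
Proof.
move=> eu h1 h2 u0 den0 ey back; right; exists u; split=> //; first by exists y.
by rewrite eu; apply: height_mobius_le.
Qed.

Lemma square_step_id a b C L (x u : rat) : (1 <= C)%BZ -> u != 0 ->
  on_curve a b x -> x = u ^+ 2 -> square_step a b C L x.
Proof.
move=> C1 u0 cx ex; right; exists u; rewrite -ex; split=> //.
by have := height_gt0 x; nia.
Qed.

(** Translation by (0, 0) sends x to b/x, and it multiplies the square class by [b]. *)
Lemma square_step_div a b C L d r (x u : rat) : (Z.abs b <= C)%BZ -> (1 <= C)%BZ ->
  d <> 0%BZ -> b <> 0%BZ -> u != 0 -> on_curve a b x -> x = zq d * u ^+ 2 ->
  (d * b = r * r)%BZ ->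
  (zq b / x \in map zq L -> x \in map zq L) ->
  square_step a b C L x.
Proof.
move=> C1 C2 d0 b0 u0 [w ew] ex dr back.
have zd0 := zq_neq0 d0; have zb0 := zq_neq0 b0.
have x0 : x != 0 by rewrite ex mulf_neq0 // sqrf_eq0.
have er : zq r ^+ 2 = zq d * zq b by rewrite expr2 -!zqM dr.
have r0 : zq r != 0 by rewrite -sqrf_eq0 er mulf_neq0.
have eu : (zq r / (zq d * u)) ^+ 2 = zq b / x.
  by rewrite ex !(exprMn, exprVn) er; field; rewrite u0 zd0.
apply: (@descent_step a b C L 0%BZ b 1%BZ 0%BZ x (zq r / (zq d * u)) (zq b * w / x ^+ 2)).
- by rewrite eu zq0 zq1 mul0r mul1r add0r addr0.
- by [].
- by [].
- by rewrite mulf_neq0 ?invr_eq0 ?mulf_neq0.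
- by rewrite zq1 zq0 mul1r addr0.
- by rewrite eu !(exprMn, exprVn) ew; field.
- by rewrite eu.
Qed.

(* If [d * e] is a square, translation by the point [(e, 0)] maps the class [d]
   of an abscissa modulo squares to the trivial one. *)
Lemma descent_full_torsion (e e' C B : Z) (D : seq Z) :
  let a := (- (e + e'))%BZ in let b := (e * e')%BZ in
  let b' := (a * a - 4 * b)%BZ in
  e <> 0%BZ -> e' <> 0%BZ -> b' <> 0%BZ ->
  (Z.abs e + Z.abs b <= C)%BZ -> (Z.abs e' + Z.abs b <= C)%BZ ->
  (1 + Z.abs e <= C)%BZ -> (1 + Z.abs e' <= C)%BZ ->
  (forall x : rat, x != 0 -> on_curve a b x ->
     exists (d : Z) (u : rat), [/\ d \in D, u != 0 & x = zq d * u ^+ 2]) ->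
  (forall d : Z, d \in D -> exists r : Z,
     [\/ d = 1%BZ, (d * b = r * r)%BZ, (d * e = r * r)%BZ | (d * e' = r * r)%BZ]) ->
  (forall x : rat, x != 0 -> on_curve (- (2 * a)) b' x ->
     exists s : rat, x = s ^+ 2 \/ x * s ^+ 2 = zq b') ->
  (forall x : rat, x != 0 -> on_curve a b x -> (height x <= B)%BZ ->
     x \in map zq [:: e; e']) ->
  (0 < B)%BZ ->
  (((2 + Z.abs a + Z.abs b) * Z.abs b) * ((2 + Z.abs a + Z.abs b) * Z.abs b) *
     ((2 + Z.abs (- (2 * a)) + Z.abs b') * Z.abs b') * (4 * C) <= B * B * B)%BZ ->
  forall x : rat, x != 0 -> on_curve a b x -> x \in map zq [:: e; e'].
Proof.
move=> a b b' e0 e'0 b'0 C1 C2 C3 C4.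
have C7 : (Z.abs b <= C)%BZ by clear -C1; lia.
have C8 : (1 <= C)%BZ by clear -C3; lia.
move=> dE dR S' search B0 const.
have ze0 := zq_neq0 e0; have ze'0 := zq_neq0 e'0.
have za : zq a = - (zq e + zq e') by rewrite zqN zqD.
have zb : zq b = zq e * zq e' by rewrite zqM.
have zee' : zq e != zq e'.
  by apply/eqP => /zq_inj h; apply: b'0; rewrite /b' /a /b h; lia.
apply: (@descent a b C B) => //.
- exact/Z.neq_mul_0.
- clear S' search const b'0 b'; clearbody a b.
  move=> z z0 cz; have [d [u [dD u0 ez]]] := dE z z0 cz.
  have [w ew] := cz; rewrite za zb in ew.
  have d0 : zq d != 0 by apply: contra_neq z0 => h; rewrite ez h mul0r.
  have [z1|z1] := eqVneq z (zq e); first by left; rewrite z1 !inE eqxx.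
  have [z2|z2] := eqVneq z (zq e'); first by left; rewrite z2 !inE eqxx orbT.
  have z1' : z - zq e != 0 by rewrite subr_eq0.
  have z2' : z - zq e' != 0 by rewrite subr_eq0.
  have w0 : w != 0.
    rewrite -sqrf_eq0 ew !mulf_neq0 //.
    have -> : z ^+ 2 + - (zq e + zq e') * z + zq e * zq e' =
      (z - zq e) * (z - zq e') by ring.
    by rewrite mulf_neq0.
  (* Translation by (f, 0) is z -> f(z - f')/(z - f), and it multiplies the square class by [f]. *)
  have translate f f' r : f <> 0%BZ -> zq f * zq f' = zq b ->
      zq f + zq f' = zq e + zq e' -> zq f != zq f' ->
      (Z.abs f + Z.abs b <= C)%BZ -> (1 + Z.abs f <= C)%BZ ->
      (d * f = r * r)%BZ -> z != zq f -> z != zq f' ->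
      (forall v, v \in map zq [:: e; e'] -> v = zq f \/ v = zq f') ->
      square_step a b C [:: e; e'] z.
    move=> f0 fb fa ff' c1 c2 dr zf zf' back.
    have f0' := zq_neq0 f0.
    have {}zf : z - zq f != 0 by rewrite subr_eq0.
    have {}zf' : z - zq f' != 0 by rewrite subr_eq0.
    have er : zq r ^+ 2 = zq d * zq f by rewrite expr2 -!zqM dr.
    have r0 : zq r != 0 by rewrite -sqrf_eq0 er mulf_neq0.
    have {}ew : w ^+ 2 = z * ((z - zq f) * (z - zq f')).
      by rewrite ew -fa -zb -fb; ring.
    have eu : (zq r * w / ((z - zq f) * (zq d * u))) ^+ 2 =
        zq f * (z - zq f') / (z - zq f).
      rewrite !(exprMn, exprVn) ew er.
      have -> : u ^+ 2 = z / zq d by rewrite ez; field.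
      by field; rewrite ?z0 ?zf ?d0.
    apply: (@descent_step a b C _ f (- b)%BZ 1%BZ (- f)%BZ z
              (zq r * w / ((z - zq f) * (zq d * u)))
              (zq f * (zq f - zq f') * w / (z - zq f) ^+ 2)).
    all: rewrite ?(zqN f) ?(zqN b) ?zq1 ?mul1r.
    all: try assumption.
    * by rewrite eu -fb mulrBr.
    * by rewrite Z.abs_opp.
    * by rewrite Z.abs_opp.
    * by rewrite !mulf_neq0 ?invr_eq0 ?mulf_neq0.
    * by rewrite eu za zb -fa -zb -fb !(exprMn, exprVn) ew; field.
    (* The translate is never [e] or [e']: this would force f = f' or z = 0. *)
    * rewrite eu => /back h; exfalso.
      have {}h : zq f * (z - zq f') = zq f * (z - zq f) \/
                 zq f * (z - zq f') = zq f' * (z - zq f).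
        by case: h => h; [left | right]; rewrite -[LHS](divfK zf) h.
      case: h => [/(mulfI f0')/addrI/oppr_inj h | h].
        by rewrite h eqxx in ff'.
      have : (zq f - zq f') * z = 0.
        have -> : (zq f - zq f') * z =
          zq f * (z - zq f') - zq f' * (z - zq f) by ring.
        by rewrite h subrr.
      by move/eqP; rewrite mulf_eq0 subr_eq0 (negPf ff') (negPf z0).
  have [r [d1|dr|dr|dr]] := dR d dD.
  + rewrite d1 zq1 mul1r in ez.
    exact: (@square_step_id a b C [:: e; e'] z u C8 u0 cz ez).
  + have d0' : d <> 0%BZ by move=> h; move: d0; rewrite h zq0 eqxx.
    have b0 : b <> 0%BZ.
      by move=> h; move/eqP: zb; rewrite h zq0 eq_sym mulf_eq0 (negPf ze0) (negPf ze'0).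
    apply: (@square_step_div a b C [:: e; e'] d r z u C7 C8 d0' b0 u0 cz ez dr).
    rewrite !inE zb => /orP[]/eqP h; apply/orP; [right | left]; apply/eqP.
      by apply: (mulfI ze0); rewrite -[RHS](divfK z0) h.
    by apply: (mulIf ze'0); rewrite -[RHS](divfK z0) h mulrC.
  + apply: (@translate e e' r) => // v; rewrite !inE => /orP[]/eqP->; by [left|right].
  + apply: (@translate e' e r) => //.
    * by rewrite mulrC.
    * by rewrite addrC.
    * by rewrite eq_sym.
    * by move=> v; rewrite !inE => /orP[]/eqP->; [right|left].
(* The isogeny sends (e, 0) and (e', 0) to (0, 0), so [s] would vanish. *)
- move=> l u s hl _ s0 es _; case/eqP: s0; apply/eqP; rewrite -sqrf_eq0 es za zb.
  by move: hl; rewrite !inE => /orP[]/eqP->; apply/eqP; field.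
Qed.

Lemma curve_32a (x y : rat) : x != 0 -> y ^+ 2 = x * (x + 1) * (x + 2) ->
  x = -1 \/ x = -2.
Proof.
have em6 : zq (- (2 * 3)) = -6 by rewrite zqE.
suff main (z : rat) : z != 0 -> on_curve 3 2 z -> z \in map zq [:: -1; -2]%BZ.
  move=> x0 ey; have := main x x0; rewrite !inE !zqE => /(_ _)/orP[|/eqP|/eqP].
  - by exists y; rewrite !zqE ey; ring.
  - by left.
  - by right.
have dE (x0 : rat) : x0 != 0 -> on_curve 3 2 x0 -> exists (d : Z) (u : rat),
    [/\ d \in [:: 1; 2; -1; -2]%BZ, u != 0 & x0 = zq d * u ^+ 2].
  move=> h cx.
  have [//|//|d [u [dD u0]]] := @on_curve_class 3%BZ 2%BZ [:: 1; 2]%BZ x0 _ _ h cx.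
  case=> ->; [exists d, u | exists (- d)%BZ, u]; rewrite ?zqN ?mulNr; split=> //;
    by move: dD; rewrite !inE => /orP[/eqP->|/eqP->].
(* The classes 1, 2, -1, -2 are exactly those of the 2-torsion. The descent constant 14^2 * 9 * 16 =
   28224 is below 32^3, and 2 * 32 < 9^2 allows a search up to 8. *)
move: z; apply: (@descent_full_torsion (-1)%BZ (-2)%BZ 4%BZ 32%BZ [:: 1; 2; -1; -2]%BZ) => //.
- by move=> d; rewrite !inE => /or4P[]/eqP->;
    [exists 0%BZ | exists 2%BZ | exists 1%BZ | exists 2%BZ];
    [apply: Or41 | apply: Or42 | apply: Or43 | apply: Or44].
- move=> z z0 cz.
  have [//|//|d [u [dD u0]]] := @on_curve_class (- (2 * 3))%BZ 1%BZ [:: 1]%BZ z _ _ z0 cz.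
  rewrite !inE in dD; rewrite (eqP dD) zq1 mul1r => -[|] ez; exists u; first by left.
  exfalso; have [w] := cz; rewrite em6 zq1 ez; have := sqr_gt0 u0; have := sqr_ge0 w.
  move: (u ^+ 2) (w ^+ 2) => U W; nra.
- apply: (@search_sound _ _ [:: 1; 2; -1; -2]%BZ _ _ 8) => //.
    by move=> d; rewrite !inE => /or4P[]/eqP->; split; lia.
  by move=> z z0 /(dE z z0) [d [u [dD _ ez]]]; exists d, u; exact: (conj dD ez).
Qed.

Lemma curve_24a2 (x y : rat) : x != 0 -> y ^+ 2 = x * (x + 1) * (x - 8) ->
  x = -1 \/ x = 8.
Proof.
have e2 : zq 2 = 2 by rewrite zqE.
have e4 : zq 4 = 4 by rewrite zqE.
have e8 : zq 8 = 8 by rewrite zqE.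
have e9 : zq 9 = 9 by rewrite zqE.
have e14 : zq 14 = 14 by rewrite zqE.
have e81 : zq 81 = 81 by rewrite zqE.
have e3 : zq 3 = 3 by rewrite zqE.
have e27 : zq 27 = 27 by rewrite zqE.
have pos (U W : rat) : 0 < U -> 0 <= W -> W = - U * (U ^+ 2 - 14 * U + 81) -> False.
  move=> U0 W0 e; have : 0 < U * ((U - 7) ^+ 2 + 32).
    by apply: mulr_gt0; [exact: U0 | have := sqr_ge0 (U - 7); lra].
  have : W = - (U * ((U - 7) ^+ 2 + 32)) by rewrite e; ring.
  lra.
suff main (z : rat) : z != 0 -> on_curve (-7) (-8) z -> z \in map zq [:: -1; 8]%BZ.
  move=> x0 ey; have := main x x0; rewrite !inE !zqE => /(_ _)/orP[|/eqP|/eqP].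
  - by exists y; rewrite !zqE ey; ring.
  - by left.
  - by right.
have dE (x0 : rat) : x0 != 0 -> on_curve (-7) (-8) x0 -> exists (d : Z) (u : rat),
    [/\ d \in [:: 1; -2; -1; 2]%BZ, u != 0 & x0 = zq d * u ^+ 2].
  move=> h cx.
  have [//|//|d [u [dD u0]]] :=
    @on_curve_class (-7)%BZ (-8)%BZ [:: 1; 2; 4; 8]%BZ x0 _ _ h cx.
  have [d' [v [dD' v0 e]]] : exists (d' : Z) (v : rat),
      [/\ d' \in [:: 1; 2]%BZ, v != 0 & zq d * u ^+ 2 = zq d' * v ^+ 2].
    move: dD; rewrite !inE => /or4P[]/eqP->;
      [exists 1%BZ, u | exists 2%BZ, u | exists 1%BZ, (2 * u) | exists 2%BZ, (2 * u)];
      (split; [by [] | by rewrite ?mulf_neq0 | rewrite ?(zq1, e2, e4, e8, e3, e9, e27, e81); ring]).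
  rewrite e; case=> ->; [exists d', v | exists (- d')%BZ, v]; rewrite ?zqN ?mulNr;
    (split; [by move: dD'; rewrite !inE => /orP[/eqP->|/eqP->] | exact: v0 | reflexivity]).
(* The descent constant 136^2 * 7857 * 64 is below 2120^3, and 2 * 2120 < 67^2 allows a search up to
   66. *)
move: z; apply: (@descent_full_torsion (-1)%BZ 8%BZ 16%BZ 2120%BZ [:: 1; -2; -1; 2]%BZ).
1-7: by [].
- exact: dE.
- by move=> d; rewrite !inE => /or4P[]/eqP->;
    [exists 0%BZ | exists 4%BZ | exists 1%BZ | exists 4%BZ];
    [apply: Or41 | apply: Or42 | apply: Or43 | apply: Or44].
- move=> z z0 cz.
  have [//|//|d [u [dD u0]]] :=
    @on_curve_class 14%BZ 81%BZ [:: 1; 3; 9; 27; 81]%BZ z _ _ z0 cz.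
  have [d' [v [dD' v0 ->]]] : exists (d' : Z) (v : rat),
      [/\ d' \in [:: 1; 3]%BZ, v != 0 & zq d * u ^+ 2 = zq d' * v ^+ 2].
    move: dD; rewrite !inE => /or4P[/eqP->|/eqP->|/eqP->|/orP[]/eqP->];
      [exists 1%BZ, u | exists 3%BZ, u | exists 1%BZ, (3 * u) | exists 3%BZ, (3 * u)
      | exists 1%BZ, (9 * u)];
      (split; [by [] | by rewrite ?mulf_neq0 | rewrite ?(zq1, e2, e4, e8, e3, e9, e27, e81); ring]).
  have [w] := cz; rewrite e14 e81 => ew.
  move: dD'; rewrite !inE => /orP[]/eqP-> [] ez.
  + by exists v; left; rewrite ez zq1 mul1r.
  + by exfalso; apply: (pos _ _ (sqr_gt0 v0) (sqr_ge0 w)); rewrite ew ez zq1; ring.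
  (* The class 3 is positive and needs a 2-adic argument: dividing by (3v)^2 leaves the quartic 3v^4
     + 14v^2 + 27. *)
  + exfalso; have := @quartic_not_square 3%BZ 14%BZ 27%BZ v (w / (3 * v)).
    apply; [by [] .. |]; rewrite expr_div_n ew ez e3 e14 e27; by field.
  + have U0 : 0 < 3 * v ^+ 2 by apply: mulr_gt0; [| exact: sqr_gt0].
    by exfalso; apply: (pos _ _ U0 (sqr_ge0 w)); rewrite ew ez e3; ring.
- apply: (@search_sound _ _ [:: 1; -2; -1; 2]%BZ _ _ 66).
  + by vm_compute.
  + by move=> d; rewrite !inE => /or4P[]/eqP->; split; lia.
  by move=> z z0 /(dE z z0) [d [u [dD _ ez]]]; exists d, u; exact: (conj dD ez).
- by [].
- by [].
Qed.


(** Only one rational 2-torsion point here, and points of order 3 (x = 1) and 6 (x = -1). Doubling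
    sends both abscissas to 1, which makes the list closed. *)
Lemma curve_20a (x y : rat) : x != 0 -> y ^+ 2 = x * (x ^+ 2 + x - 1) ->
  x = 1 \/ x = -1.
Proof.
have em1 : zq (-1) = -1 by rewrite zqE.
have em2 : zq (- (2 * 1)) = -2 by rewrite zqE.
have e5 : zq 5 = 5 by rewrite zqE.
have pos (U W : rat) : 0 < U -> 0 <= W -> W = - U * (U ^+ 2 + 2 * U + 5) -> False.
  move=> U0 W0 e; have : 0 < U * ((U + 1) ^+ 2 + 4).
    by apply: mulr_gt0; [exact: U0 | have := sqr_ge0 (U + 1); lra].
  have : W = - (U * ((U + 1) ^+ 2 + 4)) by rewrite e; ring.
  lra.
suff main (z : rat) : z != 0 -> on_curve 1 (-1) z -> z \in map zq [:: 1; -1]%BZ.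
  move=> x0 ey; have := main x x0; rewrite !inE zq1 em1 => /(_ _)/orP[|/eqP|/eqP].
  - by exists y; rewrite zq1 em1 ey; ring.
  - by left.
  - by right.
have dE (x0 : rat) : x0 != 0 -> on_curve 1 (-1) x0 -> exists (d : Z) (u : rat),
    [/\ d \in [:: 1; -1]%BZ, u != 0 & x0 = zq d * u ^+ 2].
  move=> h cx.
  have [//|//|d [u [dD u0]]] := @on_curve_class 1%BZ (-1)%BZ [:: 1]%BZ x0 _ _ h cx.
  rewrite !inE in dD; rewrite (eqP dD).
  by case=> ->; [exists 1%BZ, u | exists (-1)%BZ, u]; rewrite ?zq1 ?em1 ?mul1r ?mulN1r.
move: z; apply: (@descent 1%BZ (-1)%BZ 1%BZ 20%BZ [:: 1; -1]%BZ).
- by [].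
- by [].
- move=> z z0 cz; have [d [u [dD u0 ez]]] := dE z z0 cz.
  rewrite !inE in dD; case/orP: dD => /eqP ed; rewrite ed in ez.
    by apply: (square_step_id _ _ u0 cz) => //; rewrite ez zq1 mul1r.
  apply: (@square_step_div 1%BZ (-1)%BZ 1%BZ _ (-1)%BZ 1%BZ z u) => //.
  rewrite !inE zq1 em1 => /orP[]/eqP h; apply/orP; [right|left]; apply/eqP.
    have h' : -1 = 1 * z by rewrite -[LHS](divfK z0) h.
    lra.
  have h' : -1 = -1 * z by rewrite -[LHS](divfK z0) h.
  lra.
- move=> z z0 cz.
  have [//|//|d [u [dD u0]]] := @on_curve_class (-2)%BZ 5%BZ [:: 1; 5]%BZ z _ _ z0 cz.
  have [w] := cz; rewrite em2 e5 => ew.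
  rewrite !inE in dD; case/orP: dD => /eqP-> []; rewrite ?zq1 ?e5 ?mul1r => ez.
  + by exists u; left.
  + by exfalso; apply: (pos _ _ (sqr_gt0 u0) (sqr_ge0 w)); rewrite ew ez; ring.
  + by exists u^-1; right; rewrite ez; field.
  + have U0 : 0 < 5 * u ^+ 2 by apply: mulr_gt0; [| exact: sqr_gt0].
    by exfalso; apply: (pos _ _ U0 (sqr_ge0 w)); rewrite ew ez; ring.
- move=> l u s; rewrite !inE => hl _ _ es e4.
  have {}es : s ^+ 2 = 1.
    by move: hl es; rewrite zq1 em1 => /orP[]/eqP-> ->; rewrite ?zq1 ?em1; field.
  rewrite zq1; apply/orP; left; apply/eqP/(@mulfI _ 4) => //.
  by rewrite e4 es em2 (_ : zq _ = 5) ?e5 //; field.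
- apply: (@search_sound _ _ [:: 1; -1]%BZ _ _ 8).
  + by vm_compute.
  + by move=> d; rewrite !inE => /orP[]/eqP->; split; lia.
  by move=> z z0 /(dE z z0) [d [u [dD _ ez]]]; exists d, u; exact: (conj dD ez).
- by [].
- by [].
Qed.

(** As for [curve_20a]: x = 4 has order 3, x = 8 has order 6, and doubling sends both to 4. On the
    isogenous curve y^2 = x(x^2 + 22x - 7) the classes 1 and -7 come from torsion, and -1 and 7 are
    excluded 2-adically. *)
Lemma curve_14a (x y : rat) : x != 0 -> y ^+ 2 = x * (x ^+ 2 - 11 * x + 32) ->
  x = 8 \/ x = 4.
Proof.
have e8 : zq 8 = 8 by rewrite zqE.
have e4 : zq 4 = 4 by rewrite zqE.
have e2 : zq 2 = 2 by rewrite zqE.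
have e7 : zq 7 = 7 by rewrite zqE.
have em1 : zq (-1) = -1 by rewrite zqE.
have em7 : zq (-7) = -7 by rewrite zqE.
have e22 : zq (- (2 * -11)) = 22 by rewrite zqE.
have e22' : zq 22 = 22 by rewrite zqE.
have em11 : zq (-11) = -11 by rewrite zqE.
have e32 : zq 32 = 32 by rewrite zqE.
have pos (U W : rat) : 0 < U -> 0 <= W -> W = - U * (U ^+ 2 + 11 * U + 32) -> False.
  move=> U0 W0 e; have : 0 < U * (U ^+ 2 + 11 * U + 32).
    by apply: mulr_gt0; [exact: U0 | have := sqr_ge0 U; lra].
  have : W = - (U * (U ^+ 2 + 11 * U + 32)) by rewrite e; ring.
  lra.
suff main (z : rat) : z != 0 -> on_curve (-11) 32 z -> z \in map zq [:: 8; 4]%BZ.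
  move=> x0 ey; have := main x x0; rewrite !inE e8 e4 => /(_ _)/orP[|/eqP|/eqP].
  - by exists y; rewrite em11 e32 ey; ring.
  - by left.
  - by right.
have dE (x0 : rat) : x0 != 0 -> on_curve (-11) 32 x0 -> exists (d : Z) (u : rat),
    [/\ d \in [:: 1; 2]%BZ, u != 0 & x0 = zq d * u ^+ 2].
  move=> h cx.
  have [//|//|d [u [dD u0]]] :=
    @on_curve_class (-11)%BZ 32%BZ [:: 1; 2; 4; 8; 16; 32]%BZ x0 _ _ h cx.
  have [d' [v [dD' v0 ->]]] : exists (d' : Z) (v : rat),
      [/\ d' \in [:: 1; 2]%BZ, v != 0 & zq d * u ^+ 2 = zq d' * v ^+ 2].
    have e16 : zq 16 = 16 by rewrite zqE.
    move: dD; rewrite !inE => /or4P[/eqP->|/eqP->|/eqP->|/or3P[]/eqP->];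
      [exists 1%BZ, u | exists 2%BZ, u | exists 1%BZ, (2 * u) | exists 2%BZ, (2 * u)
      | exists 1%BZ, (4 * u) | exists 2%BZ, (4 * u)];
      (split; [by [] | by rewrite ?mulf_neq0 | rewrite ?(zq1, e2, e4, e8, e16, e32); ring]).
  case=> ez; first by exists d', v.
  have [w] := cx; rewrite em11 e32 ez => ew; exfalso.
  have U0 : 0 < zq d' * v ^+ 2.
    apply: mulr_gt0; last exact: sqr_gt0.
    by move: dD'; rewrite !inE => /orP[]/eqP->; rewrite ?zq1 ?e2.
  by apply: (pos _ _ U0 (sqr_ge0 w)); rewrite ew; ring.
(* The descent constant 1440^2 * 217 * 128 is below 3900^3, and 2 * 3900 < 91^2 allows a search up
   to 90. *)
move: z; apply: (@descent (-11)%BZ 32%BZ 32%BZ 3900%BZ [:: 8; 4]%BZ).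
- by [].
- by [].
- move=> z z0 cz; have [d [u [dD u0 ez]]] := dE z z0 cz.
  rewrite !inE in dD; case/orP: dD => /eqP ed; rewrite ed in ez.
    by apply: (square_step_id _ _ u0 cz) => //; rewrite ez zq1 mul1r.
  apply: (@square_step_div (-11)%BZ 32%BZ 32%BZ _ 2%BZ 8%BZ z u) => //.
  rewrite !inE e8 e4 e32 => /orP[]/eqP h; apply/orP; [right|left]; apply/eqP.
    have h' : 32 = 8 * z by rewrite -[LHS](divfK z0) h.
    lra.
  have h' : 32 = 4 * z by rewrite -[LHS](divfK z0) h.
  lra.
- move=> z z0 cz.
  have [//|//|d [u [dD u0]]] := @on_curve_class 22%BZ (-7)%BZ [:: 1; 7]%BZ z _ _ z0 cz.
  have [w] := cz; rewrite e22 em7 => ew.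
  rewrite !inE in dD; case/orP: dD => /eqP-> []; rewrite ?zq1 ?e7 ?mul1r => ez.
  + by exists u; left.
  + exfalso; have := @quartic_not_square (-1)%BZ 22%BZ 7%BZ u (w / u).
    by apply; [by [] .. |]; rewrite expr_div_n ew ez em1 e22' e7; field.
  + exfalso; have := @quartic_not_square 7%BZ 22%BZ (-1)%BZ u (w / (7 * u)).
    by apply; [by [] .. |]; rewrite expr_div_n ew ez em1 e22' e7; field.
  + by exists u^-1; right; rewrite ez; field.
- move=> l u s; rewrite !inE => hl _ _ es e.
  have {}es : s ^+ 2 = 1.
    by move: hl es; rewrite em11 e32 => /orP[]/eqP-> ->; rewrite ?e8 ?e4; field.
  rewrite e4; apply/orP; right; apply/eqP/(@mulfI _ 4) => //.
  by rewrite e es e22 (_ : zq _ = -7) ?em7 //; field.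
- apply: (@search_sound _ _ [:: 1; 2]%BZ _ _ 90).
  + by vm_compute.
  + by move=> d; rewrite !inE => /orP[]/eqP->; split; lia.
  by move=> z z0 /(dE z z0) [d [u [dD _ ez]]]; exists d, u; exact: (conj dD ez).
- by [].
- by [].
Qed.

(** * Excluded configurations *)

Lemma sqrt_irrational (k n : Z) (t : rat) :
  (0 <= n)%BZ -> (n * n < k < (n + 1) * (n + 1))%BZ -> t ^+ 2 <> zq k.
Proof.
move=> n0 nk h; have [s es] := zq_sqrt h.
have {es} : (s * s = k)%BZ by apply: zq_inj; rewrite zqM -h es expr2.
have [sn|sn] := Z_le_gt_dec (Z.abs s) n; nia.
Qed.

Lemma sqrt3_irrational (t : rat) : t ^+ 2 <> 3.
Proof. by have := @sqrt_irrational 3%BZ 1%BZ t; rewrite zqE; apply. Qed.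

Lemma sqrt5_irrational (t : rat) : t ^+ 2 <> 5.
Proof. by have := @sqrt_irrational 5%BZ 2%BZ t; rewrite zqE; apply. Qed.

Lemma expr4D1_neq0 (x : rat) : x ^+ 4 + 1 != 0.
Proof.
have -> : x ^+ 4 = (x ^+ 2) ^+ 2 by rewrite -exprM.
by rewrite gt_eqF // ltr_wpDl ?ltr01 ?sqr_ge0.
Qed.

(** This curve has points of order 4, at x = 3 and x = -1. Its 2-isogeny with kernel (1, 0) leads to
    [curve_24a2], which has 2-torsion only: X = (x + 1)^2/(x - 1) satisfies X + 1 = x(x + 3)/(x - 1)
    and X - 8 = (x - 3)^2/(x - 1). *)
Lemma curve_24a1 (x y : rat) : x != 0 -> x != 1 ->
  y ^+ 2 = x * (x - 1) * (x + 3) -> [\/ x = -3, x = 3 | x = -1].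
Proof.
move=> x0 x1 ey; have x1' : x - 1 != 0 by rewrite subr_eq0.
have [|xm1] := eqVneq x (-1); first by apply: Or33.
have xm1' : x + 1 != 0 by rewrite addr_eq0.
have X0 : (x + 1) ^+ 2 / (x - 1) != 0 by rewrite mulf_neq0 ?invr_eq0 ?expf_neq0.
have [|e|e] := @curve_24a2 ((x + 1) ^+ 2 / (x - 1))
  (y * (x + 1) * (x - 3) / (x - 1) ^+ 2) X0.
- by rewrite !(exprMn, exprVn) ey; field.
- apply: Or31; have {}e : (x + 1) ^+ 2 = -1 * (x - 1) by rewrite -[LHS](divfK x1') e.
  have : x * (x + 3) = 0.
    have -> : x * (x + 3) = (x + 1) ^+ 2 - -1 * (x - 1) by ring.
    by rewrite e subrr.
  by move/eqP; rewrite mulf_eq0 (negPf x0) addr_eq0 => /eqP.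
- apply: Or32; have {}e : (x + 1) ^+ 2 = 8 * (x - 1) by rewrite -[LHS](divfK x1') e.
  have : (x - 3) ^+ 2 = 0.
    have -> : (x - 3) ^+ 2 = (x + 1) ^+ 2 - 8 * (x - 1) by ring.
    by rewrite e subrr.
  by move/eqP; rewrite sqrf_eq0 subr_eq0 => /eqP.
Qed.

Section Obstructions.
Variable a : rat.
Hypotheses (a1 : a != 1) (am1 : a != -1).

Let a1' : a - 1 != 0. Proof. by rewrite subr_eq0. Qed.

Lemma fixed_sqr s : s ^+ 4 - 2 * a * s ^+ 2 + 1 = 0 ->
  s != 0 /\ a ^+ 2 - 1 = ((s ^+ 4 - 1) / (2 * s ^+ 2)) ^+ 2.
Proof.
move=> h; have s0 : s != 0.
  by apply/eqP => s0; move/eqP: h; rewrite s0 !expr0n mulr0 subr0 add0r oner_eq0.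
split=> //; have -> : a = (s ^+ 4 + 1) / (2 * s ^+ 2).
  have -> : s ^+ 4 + 1 = 2 * a * s ^+ 2 by rewrite -[RHS]addr0 -h; ring.
  by field.
by field.
Qed.

(** Both [a] and a^2 - 1 are squares, so (a - 1) a (a + 1) is one: a point with abscissa a - 1. *)
Lemma square_not_fixed t s : a = t ^+ 2 -> s ^+ 4 - 2 * a * s ^+ 2 + 1 = 0 -> False.
Proof.
move=> at2 h; have [s0 ha] := fixed_sqr h.
have [|e|e] := @curve_32a (a - 1) (t * ((s ^+ 4 - 1) / (2 * s ^+ 2))) a1'.
- by rewrite exprMn -ha -at2; ring.
- have {}e : a = 0 by rewrite -[a](subrK 1) e; ring.
  by have := expr4D1_neq0 s; rewrite -h e mulr0 mul0r subr0 eqxx.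
- by case/eqP: am1; rewrite -[a](subrK 1) e; ring.
Qed.

(** Here a(a - 1)(a + 3) is a square, and the only admissible positive abscissa, 3, is not a
    rational square. *)
Lemma square_not_square_disc t e : t != 0 -> a = t ^+ 2 ->
  (a - 1) * (a + 3) = e ^+ 2 -> False.
Proof.
move=> t0 at2 h; have a0 : a != 0 by rewrite at2 expf_neq0.
have a_gt0 : 0 < a by rewrite at2 sqr_gt0.
have [|ea|ea|ea] := @curve_24a1 a (t * e) a0 a1.
- by rewrite exprMn -h -at2; ring.
- by rewrite ea in a_gt0.
- by apply: (@sqrt3_irrational t); rewrite -at2.
- by rewrite ea in a_gt0.
Qed.

(** Up to a square, a^2 + 3 is the discriminant of the equation for the other preimages of a fixed
    point. Together with a^2 - 1 it gives a point with abscissa a^2. *)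
Lemma fixed_no_preimage s e : s ^+ 4 - 2 * a * s ^+ 2 + 1 = 0 ->
  a ^+ 2 + 3 = e ^+ 2 -> False.
Proof.
move=> h he; have [s0 ha] := fixed_sqr h.
have a0 : a ^+ 2 != 0.
  rewrite sqrf_eq0; apply/eqP => a0; have := expr4D1_neq0 s.
  by rewrite -h a0 mulr0 mul0r subr0 eqxx.
have a_ge0 := sqr_ge0 a.
have [||ea|ea|ea] := @curve_24a1 (a ^+ 2)
    (a * ((s ^+ 4 - 1) / (2 * s ^+ 2)) * e) a0.
- by rewrite sqrf_eq1 negb_or a1.
- by rewrite [LHS]exprMn [X in X * _]exprMn -ha -he; ring.
- by rewrite ea in a_ge0.
- exact: sqrt3_irrational ea.
- by rewrite ea in a_ge0.
Qed.

(** [p] maps to 0 and [z] to [p]. In w = zp the relation is quadratic in [a] with discriminant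
    w^2((w^2 - 1)^2 + 4). The quartic y^2 = w^4 - 2w^2 + 5 maps by x = w^2 to y^2 = x(x^2 - 2x + 5),
    whose 2-isogeny to [curve_20a] has the abscissa (y/2w)^2. *)
Lemma no_second_preimage_0 p z : a * p ^+ 2 = 1 ->
  a * z ^+ 2 - 1 = p * (z ^+ 3 - a * z) -> False.
Proof.
move=> ap hz; have p0 : p != 0.
  by apply/eqP => p0; move/eqP: ap; rewrite p0 expr0n mulr0 eq_sym oner_eq0.
have a_gt0 : 0 < a.
  by rewrite -(pmulr_lgt0 a (sqr_gt0 p0)) ap ltr01.
set w := z * p.
have hw : a ^+ 2 * w ^+ 2 - 1 = a * (w ^+ 3 - w).
  have -> : a ^+ 2 * w ^+ 2 - 1 = (a * z ^+ 2) * (a * p ^+ 2) - 1 by rewrite /w; ring.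
  have -> : a * (w ^+ 3 - w) = p * z ^+ 3 * (a * p ^+ 2) - a * p * z.
    by rewrite /w; ring.
  by rewrite ap !mulr1 hz; ring.
have w0 : w != 0.
  by apply/eqP => w0; move/eqP: hw; rewrite w0 !expr0n mulr0 sub0r subr0 mulr0
    oppr_eq0 oner_eq0.
pose y := 2 * a * w - (w ^+ 2 - 1).
have ey : y ^+ 2 = (w ^+ 2 - 1) ^+ 2 + 4.
  have -> : y ^+ 2 = 4 * (a ^+ 2 * w ^+ 2 - 1 - a * (w ^+ 3 - w)) +
                     (w ^+ 2 - 1) ^+ 2 + 4 by rewrite /y; ring.
  by rewrite hw; ring.
clearbody y w; have y0 : y != 0.
  by rewrite -sqrf_eq0 ey gt_eqF // ltr_wpDl // sqr_ge0.
have X0 : 0 < (y / (2 * w)) ^+ 2.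
  have w2 : 2 * w != 0 by apply: mulf_neq0.
  by apply/sqr_gt0/mulf_neq0; rewrite ?invr_eq0.
have [||e|e] := @curve_20a ((y / (2 * w)) ^+ 2)
  ((y / (2 * w)) * (w ^+ 2 - 5 / w ^+ 2) / 4).
- by rewrite gt_eqF.
- by rewrite !(exprMn, exprVn) ey; field.
- have {e} : (w ^+ 2 - 1) * (w ^+ 2 - 5) = 0.
    have -> : (w ^+ 2 - 1) * (w ^+ 2 - 5) =
      4 * w ^+ 2 * (((w ^+ 2 - 1) ^+ 2 + 4) / (4 * w ^+ 2) - 1) by field.
    have <- : (y / (2 * w)) ^+ 2 = ((w ^+ 2 - 1) ^+ 2 + 4) / (4 * w ^+ 2).
      by rewrite -ey; field.
    by rewrite e subrr mulr0.
  move/eqP; rewrite mulf_eq0 !subr_eq0 => /orP[]/eqP ew.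
    have e3 : w ^+ 3 - w = 0 by rewrite [w ^+ 3]exprS ew mulr1 subrr.
    move/eqP: hw; rewrite e3 ew mulr0 mulr1 subr_eq0 sqrf_eq1.
    by rewrite (negPf a1) (negPf am1).
  exact: sqrt5_irrational ew.
- by rewrite e in X0.
Qed.

(** With the next lemma: the conjugate parameter is again admissible, so that results about 0 and
    infinity transfer to 1 and -1. *)
Lemma dual_neq1 : (a + 3) / (a - 1) != 1.
Proof.
apply/eqP => h; have : a + 3 = 1 * (a - 1) by rewrite -[LHS](divfK a1') h.
by move=> e; have : (4 : rat) = 0 by lra.
Qed.

Lemma dual_neqm1 : (a + 3) / (a - 1) != -1.
Proof.
apply/eqP => h; have e : a + 3 = -1 * (a - 1) by rewrite -[LHS](divfK a1') h.
by case/eqP: am1; lra.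
Qed.

End Obstructions.

(** [square_not_fixed] for the conjugate map: (a - 1)(a + 3) is (a - 1)^2 times the conjugate
    parameter. *)
Lemma fixed_not_square_disc (a s e : rat) : a != 1 -> a != -1 ->
  s ^+ 4 - 2 * a * s ^+ 2 + 1 = 0 -> (a - 1) * (a + 3) = e ^+ 2 -> False.
Proof.
move=> a1 am1 hs he; have a1' : a - 1 != 0 by rewrite subr_eq0.
have s1 : s + 1 != 0.
  rewrite addr_eq0; apply/eqP => s1; case/eqP: a1; move: hs; rewrite s1 => hs.
  lra.
apply: (@square_not_fixed _ (dual_neq1 a1) (dual_neqm1 a1 am1)
  (e / (a - 1)) ((s - 1) / (s + 1))).
  by rewrite expr_div_n -he; field.
have -> : ((s - 1) / (s + 1)) ^+ 4 - 2 * ((a + 3) / (a - 1)) * ((s - 1) / (s + 1)) ^+ 2 + 1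
   = -8 * (s ^+ 4 - 2 * a * s ^+ 2 + 1) / ((a - 1) * (s + 1) ^+ 4).
  by field; rewrite a1' s1.
by rewrite hs mulr0 mul0r.
Qed.

(** [no_second_preimage_0] for the conjugate map: 1 goes to 0, and the equation of [r] becomes a'
    p^2 = 1 with p = (r - 1)/(r + 1). *)
Lemma no_second_preimage_1 (a r z : rat) : a != 1 -> a != -1 -> r != -1 ->
  r ^+ 2 - (1 + a) * r + 1 = 0 ->
  a * z ^+ 2 - 1 = r * (z ^+ 3 - a * z) -> False.
Proof.
move=> a1 am1 r1 hr hz; have a1' : a - 1 != 0 by rewrite subr_eq0.
have r1' : r + 1 != 0 by rewrite addr_eq0.
have z1' : z + 1 != 0.
  rewrite addr_eq0; apply/eqP => z1; case/eqP: a1; move: hz; rewrite z1 => hz.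
  have {hz} : (a - 1) * (r - 1) = 0.
    by rewrite -[RHS](subrr (r * ((-1) ^+ 3 - a * -1))) -[in X in _ = _ - X]hz; ring.
  move/eqP; rewrite mulf_eq0 (negPf a1') subr_eq0 => /eqP er.
  by move: hr; rewrite er => hr; lra.
apply: (@no_second_preimage_0 _ (dual_neq1 a1) (dual_neqm1 a1 am1)
   ((r - 1) / (r + 1)) ((z - 1) / (z + 1))).
  have e : (a + 3) * (r - 1) ^+ 2 = (a - 1) * (r + 1) ^+ 2.
    apply/eqP; rewrite -subr_eq0; apply/eqP.
    have -> : (a + 3) * (r - 1) ^+ 2 - (a - 1) * (r + 1) ^+ 2 =
      4 * (r ^+ 2 - (1 + a) * r + 1) by ring.
    by rewrite hr mulr0.
  rewrite expr_div_n mulrACA -invfM e divff // mulf_neq0 ?expf_neq0 //.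
apply/eqP; rewrite -subr_eq0; apply/eqP.
have -> : (a + 3) / (a - 1) * ((z - 1) / (z + 1)) ^+ 2 - 1 -
  (r - 1) / (r + 1) * (((z - 1) / (z + 1)) ^+ 3 - (a + 3) / (a - 1) * ((z - 1) / (z + 1)))
  = -8 * (a * z ^+ 2 - 1 - r * (z ^+ 3 - a * z)) / ((a - 1) * (r + 1) * (z + 1) ^+ 3).
  by field; rewrite a1' r1' z1'.
by rewrite hz subrr mulr0 mul0r.
Qed.

(* The third iterate gives [X3 / Y3]; dividing out the fixed points, a point of
   period 3 makes [A^2 - D B^2] vanish, where [u = w / q = z^2 + 1/z^2] and
   [D = (a^2 + 7)(a^4 + 3a^2 + 4)]. *)
Lemma period3_norm_form (a z : rat) :
  let X1 := a * z ^+ 2 - 1 in let Y1 := z ^+ 3 - a * z in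
  let X2 := a * X1 ^+ 2 * Y1 - Y1 ^+ 3 in let Y2 := X1 ^+ 3 - a * X1 * Y1 ^+ 2 in
  let X3 := a * X2 ^+ 2 * Y2 - Y2 ^+ 3 in let Y3 := X2 ^+ 3 - a * X2 * Y2 ^+ 2 in
  let w := z ^+ 4 + 1 in let q := z ^+ 2 in
  let A := 2 * w ^+ 3 - (a ^+ 5 + 4 * a ^+ 3 + 7 * a) * w ^+ 2 * q
    + (a ^+ 8 + 7 * a ^+ 6 + 7 * a ^+ 4 + 9 * a ^+ 2) * w * q ^+ 2
    - (a ^+ 9 + 8 * a ^+ 7 + 10 * a ^+ 5 - 8 * a ^+ 3 + 5 * a) * q ^+ 3 in
  let B := w ^+ 2 - a * (a ^+ 2 + 3) * w * q
    + (a ^+ 4 + 4 * a ^+ 2 - 1) * q ^+ 2 in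
  4 * (X3 - z * Y3) = - (X1 - z * Y1) *
    (A ^+ 2 - (a ^+ 2 + 7) * (a ^+ 4 + 3 * a ^+ 2 + 4) * ((a ^+ 2 - 1) * B * q) ^+ 2).
Proof. ring. Qed.

Lemma no_3_cycle (a z1 z2 z3 : rat) : a != 1 -> a != -1 ->
  z1 != 0 -> z1 ^+ 3 - a * z1 != 0 -> z2 ^+ 3 - a * z2 != 0 ->
  z2 * (z1 ^+ 3 - a * z1) = a * z1 ^+ 2 - 1 ->
  z3 * (z2 ^+ 3 - a * z2) = a * z2 ^+ 2 - 1 ->
  z1 * (z3 ^+ 3 - a * z3) = a * z3 ^+ 2 - 1 ->
  z1 = z2.
Proof.
move=> a1 am1 z0 Y10 Y20' e1 e2 e3.
have a2 : a ^+ 2 - 1 != 0 by rewrite subr_eq0 sqrf_eq1 negb_or a1.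
have := period3_norm_form a z1.
set X1 := a * z1 ^+ 2 - 1; set Y1 := z1 ^+ 3 - a * z1; cbv zeta.
set X2 := a * X1 ^+ 2 * Y1 - _; set Y2 := X1 ^+ 3 - _.
set X3 := a * X2 ^+ 2 * Y2 - _; set Y3 := X2 ^+ 3 - _.
have eX2 : X2 = Y1 ^+ 3 * (a * z2 ^+ 2 - 1) by rewrite /X2 /X1 -e1 -/Y1; ring.
have eY2 : Y2 = Y1 ^+ 3 * (z2 ^+ 3 - a * z2) by rewrite /Y2 /X1 -e1 -/Y1; ring.
have eX3 : X3 = Y2 ^+ 3 * (a * z3 ^+ 2 - 1).
  have h : X2 = z3 * Y2 by rewrite eX2 eY2 -e2; ring.
  by rewrite /X3 h; ring.
have eY3 : Y3 = Y2 ^+ 3 * (z3 ^+ 3 - a * z3).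
  have h : X2 = z3 * Y2 by rewrite eX2 eY2 -e2; ring.
  by rewrite /Y3 h; ring.
have -> : X3 - z1 * Y3 = 0 by rewrite eX3 eY3 -e3; ring.
clearbody X3 Y3; clear eX3 eY3 X3 Y3; clearbody Y2 X2; clear eX2 eY2 X2 Y2.
set w := z1 ^+ 4 + 1; set q := z1 ^+ 2.
set A := (_ - _ * q ^+ 3); set B := (_ + _ * q ^+ 2).
have q0 : q != 0 by rewrite expf_neq0.
rewrite mulr0 mulNr => /eqP; rewrite eq_sym oppr_eq0 mulf_eq0 => /orP[/eqP h|].
  by apply: (mulIf Y10); rewrite e1 -/X1; apply/eqP; rewrite eq_sym -subr_eq0 h.
rewrite subr_eq0 => /eqP hA; exfalso.
have [B0|B0] := eqVneq B 0.
  have A0 : A = 0.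
    by apply/eqP; rewrite -sqrf_eq0 hA B0 mulr0 mul0r expr0n mulr0.
  have h1 : (a ^+ 2 + 1) * w = a * (a ^+ 2 + 3) * q.
    (* The remainder of [A] by [B] as polynomials in [w]; dividing [B] by this linear form in turn
       leaves a multiple of ((a^2 - 1) q)^2, so [A] and [B] have no common zero. *)
    have : 2 * (a ^+ 2 - 1) ^+ 2 * q ^+ 2 * ((a ^+ 2 + 1) * w - a * (a ^+ 2 + 3) * q) =
      A - B * (2 * w - (a ^+ 5 + 2 * a ^+ 3 + a) * q) by rewrite /A /B; ring.
    have c0 : 2 * (a ^+ 2 - 1) ^+ 2 * q ^+ 2 != 0.
      by apply: mulf_neq0; [apply: mulf_neq0 |]; rewrite ?expf_neq0.
    by rewrite A0 B0 mul0r subr0 => /eqP; rewrite mulf_eq0 (negPf c0) subr_eq0 => /eqP.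
  have : - ((a ^+ 2 - 1) * q) ^+ 2 = (a ^+ 2 + 1) ^+ 2 * B
     - ((a ^+ 2 + 1) * w + a * (a ^+ 2 + 3) * q - a * (a ^+ 2 + 3) * (a ^+ 2 + 1) * q)
      * ((a ^+ 2 + 1) * w - a * (a ^+ 2 + 3) * q).
    by rewrite /B; ring.
  rewrite B0 h1 subrr !mulr0 subrr => /eqP.
  by rewrite oppr_eq0 sqrf_eq0 mulf_eq0 (negPf a2) (negPf q0).
(* Now D is a square, and D = x(x^2 - 11x + 32) at x = a^2 + 7. The abscissas 8 and 4 mean a^2 = 1
   and a^2 = -3. *)
have x0 : 0 < a ^+ 2 + 7 by have := sqr_ge0 a; lra.
have [||e|e] := @curve_14a (a ^+ 2 + 7) (A / ((a ^+ 2 - 1) * B * q)).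
- by rewrite gt_eqF.
- clearbody A B q; rewrite expr_div_n hA; field; by rewrite a2 B0 q0.
- by case/eqP: a2; lra.
- by have := sqr_ge0 a; lra.
Qed.

(** * Dynamics of g *)

Lemma g_Some a z : g a (Some z) =
  if z ^+ 3 - a * z == 0 then None
  else Some ((a * z ^+ 2 - 1) / (z ^+ 3 - a * z)).
Proof. by rewrite /g /ratmap !hornerE. Qed.

Lemma g_infty a : g a None = Some 0.
Proof.
have size_p : (size (a *: 'X^2 - 1 : {poly rat})%R <= 4)%N.
  rewrite (leq_trans (size_polyD _ _)) // size_polyN size_poly1 geq_max andbT.
  by rewrite (leq_trans (size_scale_leq _ _)) // size_polyXn.
have size_q : size ('X^3 - a *: 'X : {poly rat}) = 4%N.
  rewrite size_polyDl size_polyXn // size_polyN.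
  by rewrite (leq_ltn_trans (size_scale_leq _ _)) // size_polyX.
rewrite /g /ratmap size_q (maxn_idPr size_p) /= !coefE /=.
by rewrite !mulr0 !subr0 oner_eq0 divr1.
Qed.

Lemma g_SomeP a z w : g a (Some z) = Some w ->
  z ^+ 3 - a * z != 0 /\ w * (z ^+ 3 - a * z) = a * z ^+ 2 - 1.
Proof.
rewrite g_Some; case: eqVneq => // h [<-]; split=> //.
by rewrite divfK.
Qed.

Lemma g_NoneP a z : g a (Some z) = None -> z ^+ 3 - a * z = 0.
Proof. by rewrite g_Some; case: eqVneq. Qed.

(** In order: z is sent to 0, to infinity, to 1, to -1, or to itself. The factors z + 1 and z - 1,
    which stand for the cycle point above 1 and above -1, are divided out. *)
Definition exceptional (a z : rat) : Prop :=
  [\/ a * z ^+ 2 = 1, z ^+ 2 = a | z ^+ 2 - (1 + a) * z + 1 = 0] \/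
  (z ^+ 2 + (1 + a) * z + 1 = 0 \/ z ^+ 4 - 2 * a * z ^+ 2 + 1 = 0).

Section Dynamics.
Variable a : rat.
Hypotheses (a1 : a != 1) (am1 : a != -1).
Let f := g a.

Let a1' : a - 1 != 0. Proof. by rewrite subr_eq0. Qed.
Let am1' : a + 1 != 0. Proof. by rewrite addr_eq0. Qed.

Lemma g_one : f (Some 1) = Some (-1).
Proof.
rewrite /f g_Some !expr1n !mulr1 -opprB oppr_eq0 (negPf a1').
by congr Some; rewrite invrN mulrN divff.
Qed.

Lemma g_minus_one : f (Some (-1)) = Some 1.
Proof.
rewrite /f g_Some.
have -> : (-1) ^+ 3 - a * -1 = a - 1 by ring.
by rewrite (negPf a1') sqrrN expr1n mulr1 divff.
Qed.

Lemma g_zero : f (Some 0) = None.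
Proof. by rewrite /f g_Some expr0n mulr0 subr0 eqxx. Qed.

Lemma g_inf : f None = Some 0. Proof. exact: g_infty. Qed.

Lemma g_cyclesV P : P \in cyclesV -> f P \in cyclesV.
Proof.
rewrite !inE => /or4P[]/eqP->;
  by rewrite ?g_one ?g_minus_one ?g_zero ?g_inf ?eqxx ?orbT.
Qed.

Lemma notin_cyclesV P : P \notin cyclesV ->
  exists z, [/\ P = Some z, z != 0, z != 1 & z != -1].
Proof.
case: P => [z|]; last by rewrite !inE eqxx !orbT.
rewrite !inE !negb_or => /and4P[h1 h2 h3 _]; exists z; split=> //.
Qed.

Lemma Some_notin_cyclesV z : z != 0 -> z != 1 -> z != -1 -> Some z \notin cyclesV.
Proof. by move=> z0 z1 zm1; rewrite !inE !negb_or; apply/and4P; split. Qed.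

(** Dividing the fixed points out of the equation for period 2 leaves (a^2 - 1) z (z^4 - 1), so the
    rational 2-cycles do not depend on [a]. *)
Lemma period2_cyclesV P : f (f P) = P -> f P <> P -> P \in cyclesV.
Proof.
case: P => [z|]; last by rewrite !inE eqxx !orbT.
case e1: (f (Some z)) => [w|]; last by rewrite g_inf => -[<-].
move=> e2 ne; have [Y1 h1] := g_SomeP e1; have [Y2 h2] := g_SomeP e2.
have : (w - z) * (z * (z ^+ 2 - 1) * (z ^+ 2 + 1)) = 0.
  apply: (mulfI (mulf_neq0 a1' am1')); rewrite mulr0.
  apply: (mulfI Y1); rewrite mulr0.
  set X1 := a * z ^+ 2 - 1 in h1; set Y := z ^+ 3 - a * z in h1 Y1 *.
  have -> : Y * ((a - 1) * (a + 1) * ((w - z) * (z * (z ^+ 2 - 1) * (z ^+ 2 + 1)))) =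
     (X1 - z * Y) * ((a ^+ 2 - 1) * z * (z ^+ 4 - 1)) by rewrite -h1; ring.
  have -> : (X1 - z * Y) * ((a ^+ 2 - 1) * z * (z ^+ 4 - 1)) =
    - (a * X1 ^+ 2 * Y - Y ^+ 3 - z * (X1 ^+ 3 - a * X1 * Y ^+ 2)).
    by rewrite /X1 /Y; ring.
  rewrite -h1.
  have -> : a * (w * Y) ^+ 2 * Y - Y ^+ 3 - z * ((w * Y) ^+ 3 - a * (w * Y) * Y ^+ 2)
    = Y ^+ 3 * (a * w ^+ 2 - 1 - z * (w ^+ 3 - a * w)) by ring.
  by rewrite h2 subrr mulr0 oppr0.
have z21 : z ^+ 2 + 1 != 0 by rewrite gt_eqF // ltr_wpDl ?sqr_ge0.
move/eqP; rewrite !mulf_eq0 (negPf z21) orbF !subr_eq0 sqrf_eq1 !inE.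
case/orP => [/eqP h|]; first by case: ne; rewrite h.
by case/or3P => /eqP ->; rewrite eqxx ?orbT.
Qed.

Lemma period3_fixed P : f (f (f P)) = P -> P \notin cyclesV -> f P = P.
Proof.
move=> e3 h1.
have h2 : f P \notin cyclesV.
  by apply: contra h1 => h; rewrite -e3; do 2 apply: g_cyclesV.
have h3 : f (f P) \notin cyclesV.
  by apply: contra h1 => h; rewrite -e3; apply: g_cyclesV.
have [z1 [E1 z10 _ _]] := notin_cyclesV h1.
have [z2 [E2 _ _ _]] := notin_cyclesV h2.
have [z3 [E3 _ _ _]] := notin_cyclesV h3.
rewrite E3 E1 in e3; rewrite E2 in E3; rewrite E1 in E2.
have [Y1 k1] := g_SomeP E2; have [Y2 k2] := g_SomeP E3; have [_ k3] := g_SomeP e3.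
by rewrite E1 E2 (no_3_cycle a1 am1 z10 Y1 Y2 k1 k2 k3).
Qed.

Lemma exceptional_image z : z != 0 -> z != 1 -> z != -1 ->
  exceptional a z <-> f (Some z) \in cyclesV \/ f (Some z) = Some z.
Proof.
move=> z0 z1 zm1; split.
- have den0 : z ^+ 2 != a -> z ^+ 3 - a * z == 0 = false.
    move=> h; have -> : z ^+ 3 - a * z = z * (z ^+ 2 - a) by ring.
    by rewrite mulf_eq0 (negPf z0) subr_eq0 (negPf h).
  have [za|za] := eqVneq (z ^+ 2) a.
    move=> _; left; rewrite /f g_Some.
    have -> : z ^+ 3 - a * z = 0 by rewrite -za; ring.
    by rewrite eqxx !inE.
  have Y0 : z ^+ 3 - a * z != 0 by rewrite den0.
  rewrite /f g_Some den0 // => -[[h|h|h]|[h|h]].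
  + by left; rewrite h subrr mul0r !inE eqxx !orbT.
  + by rewrite h eqxx in za.
  + left; have -> : a * z ^+ 2 - 1 = z ^+ 3 - a * z.
      apply/eqP; rewrite -subr_eq0; apply/eqP.
      have -> : a * z ^+ 2 - 1 - (z ^+ 3 - a * z) =
        - (z + 1) * (z ^+ 2 - (1 + a) * z + 1) by ring.
      by rewrite h mulr0.
    by rewrite divff // !inE eqxx.
  + left; have -> : a * z ^+ 2 - 1 = - (z ^+ 3 - a * z).
      apply/eqP; rewrite -subr_eq0; apply/eqP.
      have -> : a * z ^+ 2 - 1 - - (z ^+ 3 - a * z) =
        (z - 1) * (z ^+ 2 + (1 + a) * z + 1) by ring.
      by rewrite h mulr0.
    by rewrite mulNr divff // !inE eqxx orbT.
  + right; have -> : a * z ^+ 2 - 1 = z * (z ^+ 3 - a * z).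
      apply/eqP; rewrite -subr_eq0; apply/eqP.
      have -> : a * z ^+ 2 - 1 - z * (z ^+ 3 - a * z) =
        - (z ^+ 4 - 2 * a * z ^+ 2 + 1) by ring.
      by rewrite h oppr0.
    by rewrite mulfK.
- case=> [|/g_SomeP[_ h]]; last first.
    right; right; have -> : z ^+ 4 - 2 * a * z ^+ 2 + 1 =
      z * (z ^+ 3 - a * z) - (a * z ^+ 2 - 1) by ring.
    by rewrite h subrr.
  rewrite !inE => /or4P[]/eqP.
  + move/g_SomeP => [_ h]; left; apply: Or33.
    have zm1' : z + 1 != 0 by rewrite addr_eq0.
    apply: (mulfI zm1'); rewrite mulr0.
    have -> : (z + 1) * (z ^+ 2 - (1 + a) * z + 1) =
      1 * (z ^+ 3 - a * z) - (a * z ^+ 2 - 1) by ring.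
    by rewrite h subrr.
  + move/g_SomeP => [_ h]; right; left.
    have z1' : z - 1 != 0 by rewrite subr_eq0.
    apply: (mulfI z1'); rewrite mulr0.
    have -> : (z - 1) * (z ^+ 2 + (1 + a) * z + 1) =
      (a * z ^+ 2 - 1) - (-1) * (z ^+ 3 - a * z) by ring.
    by rewrite h subrr.
  + move/g_SomeP => [_ h]; left; apply: Or31.
    by apply/eqP; rewrite -subr_eq0 -h mul0r.
  + move/g_NoneP => h; left; apply: Or32; apply/eqP; rewrite -subr_eq0; apply/eqP.
    by apply: (mulfI z0); rewrite mulr0 -h; ring.
Qed.

(** This bounds the tails: an exceptional point off the cycles has no rational preimage except
    possibly itself. The cases of infinity and -1 reduce to 0 and 1 by 1/z and -z. *)
Lemma image_exceptional_absurd P r : f P = Some r -> P <> Some r ->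
  r != 0 -> r != 1 -> r != -1 -> exceptional a r -> False.
Proof.
move=> e ne r0 r1 rm1.
case: P e ne => [z|]; last by rewrite g_inf => -[h]; rewrite h eqxx in r0.
move/g_SomeP => [Y0 h] ne; case=> [[k|k|k]|[k|k]].
- exact: (no_second_preimage_0 a1 am1 k (esym h)).
- have z0 : z != 0.
    by apply: contra_neq Y0 => ->; rewrite expr0n mulr0 subr0.
  apply: (@no_second_preimage_0 a a1 am1 r^-1 z^-1).
    by rewrite -k exprVn divff // expf_neq0.
  have -> : a * z^-1 ^+ 2 - 1 = - (r^-1 * (r * (z ^+ 3 - a * z))) / z ^+ 3.
    by rewrite mulKf //; field.
  by rewrite h; field; rewrite z0 r0.
- exact: (no_second_preimage_1 a1 am1 rm1 k (esym h)).
- apply: (@no_second_preimage_1 a (- r) (- z) a1 am1).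
  + by rewrite eqr_opp.
  + by rewrite -k; ring.
  + by rewrite sqrrN -h; ring.
- apply: (@fixed_no_preimage a a1 am1 r (2 * r * z + (r ^+ 2 - a)) k).
  have zr : z - r != 0 by rewrite subr_eq0; apply/eqP => zr; apply: ne; rewrite zr.
  (* The preimage [r] itself is divided out; by the equation of [r] the remaining quadratic has
     discriminant r^2 (a^2 + 3). *)
  have q : r ^+ 2 * z ^+ 2 + r * (r ^+ 2 - a) * z - 1 = 0.
    apply: (mulfI zr); rewrite mulr0.
    have -> : (z - r) * (r ^+ 2 * z ^+ 2 + r * (r ^+ 2 - a) * z - 1) =
      r * (r * (z ^+ 3 - a * z) - (a * z ^+ 2 - 1))
      - z * (r ^+ 4 - 2 * a * r ^+ 2 + 1) by ring.
    by rewrite h subrr k !mulr0 subrr.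
  have -> : (2 * r * z + (r ^+ 2 - a)) ^+ 2 =
    4 * (r ^+ 2 * z ^+ 2 + r * (r ^+ 2 - a) * z - 1)
    + (r ^+ 4 - 2 * a * r ^+ 2 + 1) + (a ^+ 2 + 3) by ring.
  by rewrite q k mulr0 !add0r.
Qed.

Hypothesis noper : forall P n, (4 <= n)%N -> ~ has_min_period f n P.

Lemma periodic_short P : periodic f P -> f P = P \/ P \in cyclesV.
Proof.
case=> n n0 en.
have ex : exists n, (0 < n)%N && (iter n f P == P) by exists n; rewrite n0 en eqxx.
case: (ex_minnP ex) => m /andP[m0 /eqP em] min.
have hm : has_min_period f m P.
  split=> // k /andP[k0 km] ek; have := min k; rewrite k0 ek eqxx => /(_ isT).
  by rewrite leqNgt km.
case: m m0 em min hm => [|[|[|[|m]]]] // _ em _ hm.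
- by left.
- have [?|/eqP ne] := eqVneq (f P) P; first by left.
  by right; apply: period2_cyclesV.
- have [?|h] := boolP (P \in cyclesV); first by right.
  by left; apply: period3_fixed.
- by case: (@noper P m.+4 isT hm).
Qed.

(** A longer tail would run through an exceptional point with a preimage other than itself. *)
Lemma preperiodicP P : preperiodic f P <->
  P \in cyclesV \/ f P \in cyclesV \/ f P = P.
Proof.
have cyc Q : Q \in cyclesV -> periodic f Q.
  by exists 2%N => //; move: H; rewrite !inE => /or4P[]/eqP->;
    rewrite /= ?(g_one, g_minus_one, g_zero, g_inf).
split; last first.
  case=> [h|[h|h]]; [exists 0%N | exists 1%N | exists 0%N] => /=.
  - exact: cyc.
  - exact: cyc.
  - by exists 1%N.
case=> m; elim: m P => [|m IH] P.
  by move/periodic_short => [h|h]; [right; right | left].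
rewrite iterSr => /IH hW; right.
have [h|h] := boolP (f P \in cyclesV); first by left.
case: hW => [hC|hW]; first by rewrite hC in h.
have [z [ez z0 z1 zm1]] := notin_cyclesV h.
rewrite ez in hW; have /(exceptional_image z0 z1 zm1) hz := hW.
have [hP|/eqP hP] := eqVneq P (Some z); first by right; rewrite ez hP.
by case: (image_exceptional_absurd ez hP z0 z1 zm1 hz).
Qed.

End Dynamics.

(** * From exceptional points to the graphs and their parameters *)

Section Structures.
Variable a : rat.
Hypotheses (a1 : a != 1) (am1 : a != -1).
Hypothesis noper : forall P n, (4 <= n)%N -> ~ has_min_period (g a) n P.
Let f := g a.
Let G := preper_structure f.

Lemma preperiodic_exceptional P : preperiodic f P <->
  P \in cyclesV \/
  exists z, [/\ P = Some z, Some z \notin cyclesV & exceptional a z].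
Proof.
rewrite (preperiodicP a1 am1 noper); split.
- have [h|h] := boolP (P \in cyclesV); first by left.
  case=> // hW; right; have [z [ez z0 z1 zm1]] := notin_cyclesV h.
  exists z; split; [exact: ez | by rewrite -ez | ].
  by apply/(exceptional_image a z0 z1 zm1); rewrite -ez.
- case=> [h|[z [ez h hz]]]; first by left.
  have [z' [[<-] z0 z1 zm1]] := notin_cyclesV h.
  by right; rewrite ez; apply/(exceptional_image a z0 z1 zm1).
Qed.

Lemma preper_structure_is (zs : seq rat) :
  uniq (cyclesV ++ [seq Some z | z <- zs]) ->
  (forall z, Some z \notin cyclesV -> exceptional a z <-> z \in zs) ->
  digraph_is G (cyclesV ++ [seq Some z | z <- zs])
    (cyclesE ++ [seq (Some z, f (Some z)) | z <- zs]).
Proof.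
move=> U hz.
have hV P : preperiodic f P <-> P \in cyclesV ++ [seq Some z | z <- zs].
  rewrite preperiodic_exceptional mem_cat; split.
    case=> [->//|[z [-> h /(hz z h) zz]]]; apply/orP; right.
    by rewrite (mem_map Some_inj).
  case/orP => [h|/mapP[z zz ez]]; first by left.
  have h : Some z \notin cyclesV.
    move: U; rewrite cat_uniq => /and3P[_ /hasPn h _]; apply: h.
    by rewrite (mem_map Some_inj).
  by right; exists z; split=> //; apply/(hz z h).
have eE : cyclesE ++ [seq (Some z, f (Some z)) | z <- zs] =
          [seq (P, f P) | P <- cyclesV ++ [seq Some z | z <- zs]].
  rewrite map_cat -map_comp /=.
  by rewrite /f (g_one a1) (g_minus_one a1) (g_zero a) (g_inf a).
split=> // P Q; rewrite eE; split.
  by case=> /hV hP ->; apply/mapP; exists P.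
by case/mapP => P' hP' [-> ->]; split=> //; apply/hV.
Qed.

(** The rational points with a nontrivial stabilizer under -z and 1/z are 0, infinity, 1 and -1. *)
Lemma uniq_orbit x : Some x \notin cyclesV ->
  uniq (cyclesV ++ [seq Some z | z <- [:: x; - x; 1 / x; - (1 / x)]]).
Proof.
case/notin_cyclesV => _ [[<-] x0 x1 xm1].
have x2 : x ^+ 2 != 1 by rewrite sqrf_eq1 negb_or x1.
have y0 : x^-1 != 0 by rewrite invr_eq0.
have xy : x * x^-1 = 1 by rewrite divff.
rewrite div1r /= !inE !negb_or.
move: (x^-1) y0 xy => y y0 xy.
have y1 : y != 1 by apply: contra_neq x1 => h; rewrite -xy h mulr1.
have ym1 : y != -1.
  by apply: contra_neq xm1 => h; move: xy; rewrite h mulrN1 => e; lra.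
have xney : x != y by apply: contra_neq x2 => h; rewrite expr2 [X in x * X]h.
have xneNy : x != - y.
  apply/eqP => h; have : - x ^+ 2 = 1 by rewrite expr2 [X in x * X]h mulrN opprK.
  by have := sqr_ge0 x; lra.
have neN (u : rat) : u != 0 -> u != - u.
  by move=> u0; apply: contra_neq u0 => h; lra.
repeat (apply/andP; split); rewrite ?(inj_eq Some_inj) //.
1-12: by rewrite eq_sym ?oppr_eq0 ?eqr_opp ?eqr_oppLR.
- exact: neN.
- by rewrite eqr_oppLR.
- by rewrite eqr_opp.
- exact: neN.
Qed.

Lemma exceptional_opp z : exceptional a (- z) <-> exceptional a z.
Proof.
have aux u : exceptional a u -> exceptional a (- u).
  case=> [[h|h|h]|[h|h]].
  - by left; apply: Or31; rewrite sqrrN.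
  - by left; apply: Or32; rewrite sqrrN.
  - by right; left; rewrite -h; ring.
  - by left; apply: Or33; rewrite -h; ring.
  - by right; right; rewrite -h; ring.
by split=> [/aux|/aux //]; rewrite opprK.
Qed.

Lemma exceptional_inv z : z != 0 -> exceptional a z -> exceptional a (1 / z).
Proof.
rewrite div1r => z0 [[h|h|h]|[h|h]].
- left; apply: Or32; apply: (mulIf (expf_neq0 2 z0)).
  by rewrite h exprVn mulVf // expf_neq0.
- by left; apply: Or31; rewrite -h exprVn divff // expf_neq0.
- left; apply: Or33; apply: (mulIf (expf_neq0 2 z0)); rewrite mul0r -h; by field.
- right; left; apply: (mulIf (expf_neq0 2 z0)); rewrite mul0r -h; by field.
- right; right; apply: (mulIf (expf_neq0 4 z0)); rewrite mul0r -h; by field.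
Qed.

Lemma mem_orbit_sqr (x z : rat) : x != 0 ->
  (z \in [:: x; - x; 1 / x; - (1 / x)]) =
  (z ^+ 2 == x ^+ 2) || (x ^+ 2 * z ^+ 2 == 1).
Proof.
move=> x0; rewrite !inE eqf_sqr -orbA; congr (_ || (_ || _)).
rewrite -exprMn sqrf_eq1; congr (_ || _).
  by rewrite (can2_eq (mulKf x0) (mulVKf x0)) mulr1 div1r.
by rewrite (can2_eq (mulKf x0) (mulVKf x0)) mulrN1 div1r.
Qed.

Lemma structure_orbit x : Some x \notin cyclesV -> exceptional a x ->
  (forall z, Some z \notin cyclesV -> exceptional a z ->
     z \in [:: x; - x; 1 / x; - (1 / x)]) ->
  let zs := [:: x; - x; 1 / x; - (1 / x)] in
  digraph_is G (cyclesV ++ [seq Some z | z <- zs])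
    (cyclesE ++ [seq (Some z, f (Some z)) | z <- zs]).
Proof.
move=> hx ex all_z zs; apply: preper_structure_is; first exact: uniq_orbit.
move=> z hz; split; first exact: all_z.
have [_ [[<-] x0 _ _]] := notin_cyclesV hx.
have ey := exceptional_inv x0 ex.
by rewrite !inE => /or4P[]/eqP->; rewrite ?exceptional_opp.
Qed.

Lemma disc_plus z : z ^+ 2 - (1 + a) * z + 1 = 0 ->
  (a - 1) * (a + 3) = (2 * z - (1 + a)) ^+ 2.
Proof.
move=> h; have -> : (2 * z - (1 + a)) ^+ 2 =
  4 * (z ^+ 2 - (1 + a) * z + 1) + (a - 1) * (a + 3) by ring.
by rewrite h mulr0 add0r.
Qed.

Lemma disc_minus z : z ^+ 2 + (1 + a) * z + 1 = 0 ->
  (a - 1) * (a + 3) = (2 * z + (1 + a)) ^+ 2.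
Proof.
move=> h; have -> : (2 * z + (1 + a)) ^+ 2 =
  4 * (z ^+ 2 + (1 + a) * z + 1) + (a - 1) * (a + 3) by ring.
by rewrite h mulr0 add0r.
Qed.

Lemma inv_square z : a * z ^+ 2 = 1 -> z != 0 /\ a = z^-1 ^+ 2.
Proof.
move=> h; have z0 : z != 0.
  by apply/eqP => z0; move/eqP: h; rewrite z0 expr0n mulr0 eq_sym oner_eq0.
split=> //; apply: (mulIf (expf_neq0 2 z0)).
by rewrite h exprVn mulVf // expf_neq0.
Qed.

Lemma param2_exceptional t : param2 a t ->
  Some t \notin cyclesV /\ t ^+ 4 - 2 * a * t ^+ 2 + 1 = 0.
Proof.
case=> t1 tm1 t0 ea; split; first exact: Some_notin_cyclesV.
by rewrite ea; field.
Qed.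

Lemma exceptional_param2 t : Some t \notin cyclesV ->
  t ^+ 4 - 2 * a * t ^+ 2 + 1 = 0 -> param2 a t.
Proof.
move=> /notin_cyclesV[_ [[<-] t0 t1 tm1]] h; split=> //.
have -> : t ^+ 4 + 1 = a * (2 * t ^+ 2) by rewrite -[RHS]addr0 -h; ring.
by rewrite mulfK // mulf_neq0 ?expf_neq0.
Qed.

Lemma param3a_exceptional t : param3a a t ->
  Some (1 / t) \notin cyclesV /\ a * (1 / t) ^+ 2 = 1.
Proof.
case=> t0 ea; split; last by rewrite ea; field.
have [t1 tm1] : t != 1 /\ t != -1.
  by apply/andP; rewrite -negb_or -sqrf_eq1 -ea.
apply: Some_notin_cyclesV; rewrite div1r.
- by rewrite invr_eq0.
- by rewrite invr_eq1.
- by rewrite -eqr_oppLR -invrN invr_eq1 eqr_oppLR.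
Qed.

(** The parameter comes from a = r + 1/r - 1 with r = (2t + 1)/(t + 2). The excluded t are those
    where r is infinity, 0 or -1; r = 1 would give a = 1. *)
Lemma param3b_exceptional t : param3b a t ->
  exists2 r, Some r \notin cyclesV & r ^+ 2 - (1 + a) * r + 1 = 0.
Proof.
case=> t2 th tm1 ea.
have t2' : t + 2 != 0 by rewrite addr_eq0.
have th' : 2 * t + 1 != 0.
  by apply: contra_neq th => h; lra.
have den : 2 * t ^+ 2 + 5 * t + 2 = (2 * t + 1) * (t + 2) by ring.
have rr : ((2 * t + 1) / (t + 2)) ^+ 2 - (1 + a) * ((2 * t + 1) / (t + 2)) + 1 = 0.
  by rewrite ea den; field; rewrite th' t2'.
exists ((2 * t + 1) / (t + 2)) => //; apply: Some_notin_cyclesV.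
- by rewrite mulf_neq0 ?invr_eq0.
- by apply: contra_neq a1 => h; move: rr; rewrite h => rr; lra.
- apply: contra_neq tm1 => h.
  have : 2 * t + 1 = -1 * (t + 2) by rewrite -[LHS](divfK t2') h.
  by move=> e; lra.
Qed.

Lemma exceptional_param3b r : Some r \notin cyclesV ->
  r ^+ 2 - (1 + a) * r + 1 = 0 -> exists t, param3b a t.
Proof.
move=> /notin_cyclesV[_ [[<-] r0 r1 rm1]] h.
have ea : a = (r ^+ 2 - r + 1) / r.
  have -> : r ^+ 2 - r + 1 = a * r by rewrite -[RHS]addr0 -h; ring.
  by rewrite mulfK.
(* r = 2 is t = infinity, but [a] is unchanged under r -> 1/r, and r = 1/2 is t = 0. *)
have [r2|r2] := eqVneq r 2.
  by exists 0; split=> //; rewrite ea r2; field.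
have r2' : 2 - r != 0 by rewrite subr_eq0 eq_sym.
have r1' : r + 1 != 0 by rewrite addr_eq0.
have aux (c : rat) : (2 * r - 1) / (2 - r) = c -> 2 * r - 1 = c * (2 - r).
  by move=> <-; rewrite divfK.
exists ((2 * r - 1) / (2 - r)); split.
- by apply/eqP => /aux e; have : (3 : rat) = 0 by lra.
- by apply/eqP => /aux e; case/eqP: r0; lra.
- by apply/eqP => /aux e; case/eqP: rm1; lra.
- rewrite ea.
  have -> : 2 * ((2 * r - 1) / (2 - r)) ^+ 2 + 5 * ((2 * r - 1) / (2 - r)) + 2 =
    9 * r / (2 - r) ^+ 2 by field.
  by field; rewrite r0 r2'.
Qed.

Lemma image_eq z w : z != 0 -> z ^+ 2 != a ->
  a * z ^+ 2 - 1 = w * (z ^+ 3 - a * z) -> f (Some z) = Some w.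
Proof.
move=> z0 za h; have Y0 : z ^+ 3 - a * z != 0.
  have -> : z ^+ 3 - a * z = z * (z ^+ 2 - a) by ring.
  by rewrite mulf_neq0 ?subr_eq0.
by rewrite /f g_Some (negPf Y0) h mulfK.
Qed.

Lemma sqr_neq1 : a ^+ 2 != 1.
Proof. by rewrite sqrf_eq1 negb_or a1. Qed.

Lemma fixed_image z : z ^+ 4 - 2 * a * z ^+ 2 + 1 = 0 -> f (Some z) = Some z.
Proof.
move=> h; apply: image_eq.
- by case: (fixed_sqr h).
- apply: contra_neq sqr_neq1 => za; move: h.
  have -> : z ^+ 4 = (z ^+ 2) ^+ 2 by ring.
  by rewrite za => h; lra.
- apply/eqP; rewrite -subr_eq0; apply/eqP; apply: oppr_inj.
  by rewrite oppr0 -h; ring.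
Qed.

Lemma image_0 z : a * z ^+ 2 = 1 -> f (Some z) = Some 0.
Proof.
move=> h; have [z0 _] := inv_square h; apply: image_eq => //.
  by apply: contra_neq sqr_neq1 => za; rewrite -h za.
by rewrite h subrr mul0r.
Qed.

Lemma image_infty z : z ^+ 2 = a -> f (Some z) = None.
Proof.
move=> za; rewrite /f g_Some (_ : z ^+ 3 - a * z = 0) ?eqxx //.
by rewrite -za; ring.
Qed.

Lemma image_1 z : Some z \notin cyclesV -> z ^+ 2 - (1 + a) * z + 1 = 0 ->
  f (Some z) = Some 1.
Proof.
move=> /notin_cyclesV[_ [[<-] z0 z1 zm1]] h; apply: image_eq => //.
  apply: contra_neq z1 => za.
  have a0 : 1 + a != 0 by rewrite addrC addr_eq0.
  apply: (mulfI a0); apply/eqP; rewrite -subr_eq0; apply/eqP.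
  by apply: oppr_inj; rewrite oppr0 -h za; ring.
apply/eqP; rewrite -subr_eq0; apply/eqP; rewrite mul1r.
have -> : a * z ^+ 2 - 1 - (z ^+ 3 - a * z) =
  - (z + 1) * (z ^+ 2 - (1 + a) * z + 1) by ring.
by rewrite h mulr0.
Qed.

Lemma image_opp z w : f (Some z) = Some w -> z != 0 -> f (Some (- z)) = Some (- w).
Proof.
move=> /g_SomeP[Y0 h] z0; apply: image_eq; rewrite ?oppr_eq0 // sqrrN.
  by apply: contra_neq Y0 => za; rewrite -za; ring.
by rewrite -h; ring.
Qed.

Lemma G2_structure t : param2 a t -> is_G2 t G.
Proof.
move=> /param2_exceptional[ht h].
have := @structure_orbit t ht; rewrite /is_G2 /=.
have [_ [[<-] t0 _ _]] := notin_cyclesV ht.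
have fixN s : s ^+ 4 - 2 * a * s ^+ 2 + 1 = 0 -> f (Some (- s)) = Some (- s).
  by move=> hs; apply: fixed_image; rewrite -hs; ring.
have hi : (1 / t) ^+ 4 - 2 * a * (1 / t) ^+ 2 + 1 = 0.
  by apply: (mulIf (expf_neq0 4 t0)); rewrite mul0r -h; field.
rewrite (fixed_image h) (fixN _ h) (fixed_image hi) (fixN _ hi); apply.
  by right; right.
move=> z hz; rewrite mem_orbit_sqr // => -[[k|k|k]|[k|k]].
- by have [_ ea] := inv_square k; case: (square_not_fixed a1 am1 ea h).
- by case: (square_not_fixed a1 am1 (esym k) h).
- by case: (fixed_not_square_disc a1 am1 h (disc_plus k)).
- by case: (fixed_not_square_disc a1 am1 h (disc_minus k)).
(* In z^2 the fixed point equation is a quadratic with product of roots 1, so z^2 is t^2 or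
   1/t^2. *)
- have : (z ^+ 2 - t ^+ 2) * (t ^+ 2 * z ^+ 2 - 1) = 0.
    have -> : (z ^+ 2 - t ^+ 2) * (t ^+ 2 * z ^+ 2 - 1) =
      t ^+ 2 * (z ^+ 4 - 2 * a * z ^+ 2 + 1) - z ^+ 2 * (t ^+ 4 - 2 * a * t ^+ 2 + 1).
      by ring.
    by rewrite h k !mulr0 subrr.
  by move/eqP; rewrite mulf_eq0 !subr_eq0.
Qed.

Lemma G3a_structure t : param3a a t -> is_G3a G.
Proof.
move=> h3; have [t0 ea] := h3; have [hx h] := param3a_exceptional h3.
set x := 1 / t in hx h.
exists (Some x), (Some (- x)), (Some (1 / x)), (Some (- (1 / x))).
have [x0 ex] := inv_square h.
have := @structure_orbit x hx; rewrite /=.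
rewrite (image_0 h) (@image_0 (- x)) ?sqrrN // !div1r.
rewrite (image_infty (esym ex)) (@image_infty (- x^-1)) ?sqrrN //; apply.
  by left; apply: Or31.
move=> z hz; rewrite -div1r mem_orbit_sqr // => -[[k|k|k]|[k|k]].
- apply/orP; left; have a0 : a != 0 by rewrite ea expf_neq0.
  by apply/eqP/(mulfI a0); rewrite h.
- by apply/orP; right; rewrite k mulrC h.
- by case: (square_not_square_disc a1 t0 ea (disc_plus k)).
- by case: (square_not_square_disc a1 t0 ea (disc_minus k)).
- by case: (square_not_fixed a1 am1 ea k).
Qed.

Lemma digraph_is_eq_mem (T : eqType) (H : digraph T) V V' E E' :
  perm_eq V V' -> E =i E' -> digraph_is H V E -> digraph_is H V' E'.
Proof.
move=> pV eE [U hV hE]; split; first by rewrite -(perm_uniq pV).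
  by move=> P; rewrite -(perm_mem pV).
by move=> P Q; rewrite -eE.
Qed.

Lemma G3b_structure t : param3b a t -> is_G3b G.
Proof.
case/param3b_exceptional => r hr h.
have [_ [[<-] r0 r1 rm1]] := notin_cyclesV hr.
exists (Some r), (Some (1 / r)), (Some (- r)), (Some (- (1 / r))).
have hi : (1 / r) ^+ 2 - (1 + a) * (1 / r) + 1 = 0.
  by apply: (mulIf (expf_neq0 2 r0)); rewrite mul0r -h; field.
have r0' : 1 / r != 0 by rewrite div1r invr_eq0.
have hr' : Some (1 / r) \notin cyclesV.
  apply: Some_notin_cyclesV; rewrite // div1r ?invr_eq1 //.
  by rewrite -eqr_oppLR -invrN invr_eq1 eqr_oppLR.
have f1 := image_1 hr h; have f2 := image_1 hr' hi.
have f3 := image_opp f1 r0; have f4 := image_opp f2 r0'.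
have := @structure_orbit r hr; rewrite /= f1 f2 f3 f4 => H.
(* [is_G3] lists both preimages of 1 first, here r and 1/r, whereas -r comes second in the orbit. *)
have perm4 (T : eqType) (s : seq T) u v w x :
    perm_eq (s ++ [:: u; v; w; x]) (s ++ [:: u; w; v; x]).
  rewrite perm_cat2l perm_cons.
  by rewrite -(cat1s v) -(cat1s w) -(cat1s w [:: v; x]) -(cat1s v [:: x]) perm_catCA.
apply: (digraph_is_eq_mem (perm4 _ cyclesV _ _ _ _) (perm_mem (perm4 _ cyclesE _ _ _ _))).
apply: H; first by left; apply: Or33.
have quad z : z ^+ 2 - (1 + a) * z + 1 = 0 -> z = r \/ z = 1 / r.
  move=> k; have : (z - r) * (z - 1 / r) = 0.
    have -> : (z - r) * (z - 1 / r) = (z ^+ 2 - (1 + a) * z + 1)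
        - z / r * (r ^+ 2 - (1 + a) * r + 1) by field.
    by rewrite h k mulr0 subrr.
  by move/eqP; rewrite mulf_eq0 !subr_eq0 => /orP[]/eqP; [left|right].
move=> z hz [[k|k|k]|[k|k]].
- have [z0 ea] := inv_square k; rewrite -invr_eq0 in z0.
  by case: (square_not_square_disc a1 z0 ea (disc_plus h)).
- have [_ [[<-] z0 _ _]] := notin_cyclesV hz.
  by case: (square_not_square_disc a1 z0 (esym k) (disc_plus h)).
- by rewrite !inE; case: (quad z k) => ->; rewrite eqxx ?orbT.
- rewrite !inE -[z]opprK; case: (quad (- z)) => [|->|->]; rewrite ?eqxx ?orbT //.
  by rewrite -k; ring.
- by case: (fixed_not_square_disc a1 am1 k (disc_plus h)).
Qed.

Lemma exceptional_param z : Some z \notin cyclesV -> exceptional a z ->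
  [\/ param2 a z, exists t, param3a a t | exists t, param3b a t].
Proof.
move=> hz [[k|k|k]|[k|k]].
- have [z0 ea] := inv_square k; apply: Or32; exists z^-1; split=> //.
  by rewrite invr_eq0.
- have [_ [[<-] z0 _ _]] := notin_cyclesV hz.
  by apply: Or32; exists z.
- by apply: Or33; apply: exceptional_param3b hz k.
- apply: Or33; apply: (@exceptional_param3b (- z)); last by rewrite -k; ring.
  have [_ [[<-] z0 z1 zm1]] := notin_cyclesV hz.
  by apply: Some_notin_cyclesV; rewrite ?oppr_eq0 ?eqr_oppLR ?opprK.
- by apply: Or31; apply: exceptional_param2.
Qed.

Lemma param_exceptional t : param2 a t \/ param3a a t \/ param3b a t ->
  exists2 z, Some z \notin cyclesV & exceptional a z.
Proof.
case=> [/param2_exceptional[ht h]|[/param3a_exceptional[ht h]|/param3b_exceptional[r hr h]]].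
- by exists t => //; right; right.
- by exists (1 / t) => //; left; apply: Or31.
- by exists r => //; left; apply: Or33.
Qed.

Lemma G1_structure : is_G1 G <->
  ~ exists t, param2 a t \/ param3a a t \/ param3b a t.
Proof.
split=> [[_ hV _] [t /param_exceptional[z hz ez]]|no].
  by case/negP: (hz); apply/(hV (Some z))/preperiodic_exceptional; right; exists z.
apply: (@preper_structure_is [::]) => // z hz; split=> // ez; exfalso; apply: no.
case: (exceptional_param hz ez) => [h|[t h]|[t h]].
- by exists z; left.
- by exists t; right; left.
- by exists t; right; right.
Qed.

Lemma G2_iff t : is_G2 t G <-> param2 a t.
Proof.
split; last exact: G2_structure.
case=> U _ hE; have ht : Some t \notin cyclesV.
  move: U; rewrite cat_uniq => /and3P[_ /hasPn h _]; apply: h.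
  by rewrite inE eqxx.
apply: exceptional_param2 => //.
have [_ /esym /g_SomeP[_ h]] : edge G (Some t) (Some t).
  by apply/hE; rewrite !inE eqxx !orbT.
have -> : t ^+ 4 - 2 * a * t ^+ 2 + 1 =
  t * (t ^+ 3 - a * t) - (a * t ^+ 2 - 1) by ring.
by rewrite h subrr.
Qed.

(** A single vertex off the cycles with image [A] already yields a parameter, which gives the
    converse for both graphs. *)
Lemma G3_vertex A B : is_G3 A B G ->
  exists2 z, Some z \notin cyclesV & f (Some z) = A.
Proof.
case=> P1 [P2 [Q1 [Q2 [U _ hE]]]]; have hP : P1 \notin cyclesV.
  move: U; rewrite cat_uniq => /and3P[_ /hasPn h _]; apply: h.
  by rewrite inE eqxx.
have [z [ez _ _ _]] := notin_cyclesV hP.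
exists z; rewrite -ez //; have [_ ->//] : edge G P1 A.
by apply/hE; rewrite mem_cat !inE eqxx !orbT.
Qed.

Lemma G3a_iff : is_G3a G <-> exists t, param3a a t.
Proof.
split=> [/G3_vertex[z hz /g_SomeP[_ h]]|[t]]; last exact: G3a_structure.
have [z0 ea] : z != 0 /\ a = z^-1 ^+ 2.
  by apply: inv_square; apply/eqP; rewrite -subr_eq0 -h mul0r.
by exists z^-1; split; rewrite ?invr_eq0.
Qed.

Lemma G3b_iff : is_G3b G <-> exists t, param3b a t.
Proof.
split=> [/G3_vertex[z hz /g_SomeP[_ h]]|[t]]; last exact: G3b_structure.
apply: (exceptional_param3b hz).
have [_ [[<-] z0 z1 zm1]] := notin_cyclesV hz.
have zm1' : z + 1 != 0 by rewrite addr_eq0.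
apply: (mulfI zm1'); rewrite mulr0.
have -> : (z + 1) * (z ^+ 2 - (1 + a) * z + 1) =
  1 * (z ^+ 3 - a * z) - (a * z ^+ 2 - 1) by ring.
by rewrite h subrr.
Qed.

Lemma structure_classification :
  is_G1 G \/ (exists t, is_G2 t G) \/ is_G3a G \/ is_G3b G.
Proof.
have [[t [h|[h|h]]]|no] :=
  classic (exists t, param2 a t \/ param3a a t \/ param3b a t).
- by right; left; exists t; apply: G2_structure.
- by right; right; left; apply: G3a_structure h.
- by right; right; right; apply: G3b_structure h.
- by left; apply/G1_structure.
Qed.

End Structures.

Theorem theorem6p15
  (noper : ~ exists (a : rat) (P : P1Q) (n : nat),
     [/\ a != 1, a != -1, (4 <= n)%N & has_min_period (g a) n P]) :
  (forall a : rat, a != 1 -> a != -1 ->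
     let G := preper_structure (g a) in
     [/\ is_G1 G \/ (exists t : rat, is_G2 t G) \/ is_G3a G \/ is_G3b G,
         is_G1 G <-> ~ (exists t : rat,
                          param2 a t \/ param3a a t \/ param3b a t),
         forall t : rat, is_G2 t G <-> param2 a t,
         is_G3a G <-> exists t : rat, param3a a t &
         is_G3b G <-> exists t : rat, param3b a t]) /\
  [/\ exists a : rat, [/\ a != 1, a != -1 & is_G1 (preper_structure (g a))],
      exists a : rat, [/\ a != 1, a != -1 &
        exists t : rat, is_G2 t (preper_structure (g a))],
      exists a : rat, [/\ a != 1, a != -1 & is_G3a (preper_structure (g a))] &
      exists a : rat, [/\ a != 1, a != -1 & is_G3b (preper_structure (g a))]].
Proof.
have np a : a != 1 -> a != -1 ->
    forall P n, (4 <= n)%N -> ~ has_min_period (g a) n P.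
  by move=> a1 am1 P n n4 h; apply: noper; exists a, P, n.
split=> [a a1 am1 G|].
  split.
  - exact: (structure_classification a1 am1 (np a a1 am1)).
  - exact: (G1_structure a1 am1 (np a a1 am1)).
  - by move=> t; apply: (G2_iff a1 am1 (np a a1 am1)).
  - exact: (G3a_iff a1 am1 (np a a1 am1)).
  - exact: (G3b_iff a1 am1 (np a a1 am1)).
have ex (a : rat) : a != 1 -> a != -1 -> forall S : digraph P1Q -> Prop,
    S (preper_structure (g a)) ->
    exists a, [/\ a != 1, a != -1 & S (preper_structure (g a))].
  by move=> a1 am1 S hS; exists a.
split.
(* At a = 0 none of the three formulas is solvable: t^4 + 1 and t^2 + t + 1 have no rational zero,
   and the second formula excludes t = 0. *)
- have [a1 am1] : (0 : rat) != 1 /\ (0 : rat) != -1 by [].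
  apply: (ex 0 a1 am1); apply/(G1_structure a1 am1 (np 0 a1 am1)).
  case=> t [[_ _ t0 e]|[[t0 e]|[t2 th _ e]]].
  + have : t ^+ 4 + 1 = 0 * (2 * t ^+ 2) by rewrite e divfK // mulf_neq0 ?expf_neq0.
    by rewrite mul0r => h; have := expr4D1_neq0 t; rewrite h eqxx.
  + by move/eqP: e; rewrite eq_sym sqrf_eq0 (negPf t0).
  + have d0 : 2 * t ^+ 2 + 5 * t + 2 != 0.
      have -> : 2 * t ^+ 2 + 5 * t + 2 = (t + 2) * (2 * (t - - (1 / 2))) by field.
      by rewrite !mulf_neq0 ?subr_eq0 ?addr_eq0.
    have : 3 * t ^+ 2 + 3 * t + 3 = 0 * (2 * t ^+ 2 + 5 * t + 2) by rewrite e divfK.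
    by have := sqr_ge0 (2 * t + 1); rewrite mul0r => h1 h2; lra.
- have [a1 am1] : (17 / 8 : rat) != 1 /\ (17 / 8 : rat) != -1 by [].
  apply: (ex _ a1 am1 (fun G => exists t, is_G2 t G)); exists 2.
  apply/(G2_iff a1 am1 (np _ a1 am1)); split=> //; by field.
- have [a1 am1] : (4 : rat) != 1 /\ (4 : rat) != -1 by [].
  apply: (ex _ a1 am1); apply/(G3a_iff a1 am1 (np _ a1 am1)).
  by exists 2; split=> //; ring.
- have [a1 am1] : (3 / 2 : rat) != 1 /\ (3 / 2 : rat) != -1 by [].
  apply: (ex _ a1 am1); apply/(G3b_iff a1 am1 (np _ a1 am1)).
  by exists 0; split=> //; field.
Qed.
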